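(* Let $\gamma\ge 1$, $\mu>0$, $k>0$, and let $h(\rho)=\ln\rho$ if $\gamma=1$ and $h(\rho)=\frac{\gamma}{\gamma-1}\rho^{\gamma-1}$ if $\gamma>1$. Suppose that the end states $P^{\pm}>0$, $u^{\pm}\in\mathbb{R}$ and the speed $s\in\mathbb{R}$ satisfy the Rankine--Hugoniot conditions $$s\big((P^+)^2-(P^-)^2\big)=(P^+)^2u^+-(P^-)^2u^-,$$ $$s(u^+-u^-)=\Big(\tfrac{(u^+)^2}{2}+h((P^+)^2)\Big)-\Big(\tfrac{(u^-)^2}{2}+h((P^-)^2)\Big).$$ Define the constants $A=(s-u^{\pm})(P^{\pm})^2$ and $B=su^{\pm}-\frac{(u^{\pm})^2}{2}-h((P^{\pm})^2)$ (the two choices of sign give the same value by the Rankine--Hugoniot conditions), and for $P>0$ the function $$f(P)=\Big(\frac12\Big(\frac{A^2}{P^4}-s^2\Big)+h(P^2)+B\Big)P.$$ Consider the first-order system $$P'=Q,\qquad Q'=\frac{f(P)}{k^2}-\frac{2s\mu}{k^2}\,Q .$$ (i) If $s>0$ and $0<P^+<P^-$, then there exists a heteroclinic orbit of this system connecting $[P^-,0]$ to $[P^+,0]$. If in addition $$\frac{s\mu}{k}<\sqrt{-f'(P^+)},$$ then the heteroclinic is non-monotone. (ii) If $s<0$ and $0<P^-<P^+$, then there exists a heteroclinic orbit of this system connecting $[P^-,0]$ to $[P^+,0]$. If in addition $$-\frac{s\mu}{k}<\sqrt{-f'(P^-)},$$ then the heteroclinic is non-monotone.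
   Context: A heteroclinic orbit connecting $[P^-,0]$ to $[P^+,0]$ is a solution $[P(y),Q(y)]$ of the system, defined for all $y\in\mathbb{R}$ with $P(y)>0$ (here $'=d/dy$), such that $[P(y),Q(y)]\to[P^-,0]$ as $y\to-\infty$ and $[P(y),Q(y)]\to[P^+,0]$ as $y\to+\infty$. It is called non-monotone if its component $P(y)$ is not a monotone function of $y$. The points $[P^{\pm},0]$ are equilibria of the system. *)

(* Defs.v *)
From Stdlib Require Import Reals Lra.
From Coquelicot Require Import Coquelicot.

Open Scope R_scope.

(* Meant for gamma >= 1 and rho > 0. *)
Definition enthalpy (gamma rho : R) : R :=
  if Req_dec_T gamma 1 then ln rho
  else gamma / (gamma - 1) * Rpower rho (gamma - 1).

(* In terms of P = sqrt rho, where rho is the density: [Pm, um] is the end state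
   at -oo and [Pp, up] the end state at +oo. *)
Definition rankine_hugoniot (gamma s Pm um Pp up : R) : Prop :=
  s * (Pp ^ 2 - Pm ^ 2) = Pp ^ 2 * up - Pm ^ 2 * um /\
  s * (up - um) =
    (up ^ 2 / 2 + enthalpy gamma (Pp ^ 2)) - (um ^ 2 / 2 + enthalpy gamma (Pm ^ 2)).

Definition constA (s P u : R) : R := (s - u) * P ^ 2.

Definition constB (gamma s P u : R) : R :=
  s * u - u ^ 2 / 2 - enthalpy gamma (P ^ 2).

Definition profile_f (gamma s A B P : R) : R :=
  (1 / 2 * (A ^ 2 / P ^ 4 - s ^ 2) + enthalpy gamma (P ^ 2) + B) * P.

Definition solves_system (k mu s : R) (f P Q : R -> R) : Prop :=
  forall y : R,
    is_derive P y (Q y) /\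
    is_derive Q y (f (P y) / k ^ 2 - 2 * s * mu / k ^ 2 * Q y).

Definition heteroclinic (k mu s : R) (f : R -> R) (Pm Pp : R) (P Q : R -> R) : Prop :=
  solves_system k mu s f P Q /\
  (forall y : R, 0 < P y) /\
  is_lim P m_infty Pm /\ is_lim Q m_infty 0 /\
  is_lim P p_infty Pp /\ is_lim Q p_infty 0.

(* [increasing] and [decreasing] are the non-strict notions. *)
Definition non_monotone (P : R -> R) : Prop := ~ (increasing P \/ decreasing P).

(* A and B may be computed from either end state. *)
Lemma constA_pm (gamma s Pm um Pp up : R) :
  rankine_hugoniot gamma s Pm um Pp up -> constA s Pp up = constA s Pm um.
Proof. intros [H _]; unfold constA; nra. Qed.

Lemma constB_pm (gamma s Pm um Pp up : R) :
  rankine_hugoniot gamma s Pm um Pp up -> constB gamma s Pp up = constB gamma s Pm um.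
Proof. intros [_ H]; unfold constB; lra. Qed.

(* With [constA_pm] and [constB_pm]: [Pm, 0] and [Pp, 0] are equilibria. *)
Lemma profile_f_end (gamma s P u : R) :
  0 < P -> profile_f gamma s (constA s P u) (constB gamma s P u) P = 0.
Proof. intros HP; unfold profile_f, constA, constB; field; lra. Qed.

(* Main.v *)
Require Import Defs.
From Stdlib Require Import Reals Lra Lia Classical Ranalysis5.
From Coquelicot Require Import Coquelicot.

Open Scope R_scope.

(** Write [a < b] for the two end values of [P], and [phi = f / k^2], [c = 2 |s| mu / k^2].
    The substitution [y -> - y], [Q -> - Q] replaces [s] by [- s] and exchanges the end
    states, so only [s > 0] needs work: the system is then a damped particle
    [P'' = phi P - c P'] in the potential [V] with [V' = - phi], and the orbit has to
    leave [b] and end at [a].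

    Shape of the potential.  Write [f P = g P * P].  Then
    [g' P = 2 P^-5 (gamma P^(2 (gamma + 1)) - A^2)], where the bracket is increasing, so
    [g] first decreases and then increases.  Since [g] vanishes at [a] and at [b], it is
    positive on [(0, a)] and negative on [(a, b)] ([profile_factor_valley]).  Hence [a] is
    the bottom of a well and [b] a hill.  Near 0, [f] is at least of order [P^-3], whose
    integral diverges, so some point [eta < a] has [V eta >= V b]
    ([profile_integral_nonneg]): the wall on the left of the well is higher than the hill.

    Existence ([damped_heteroclinic_exists]).  The vector field is replaced by globally
    Lipschitz ones that agree with it where the orbit lives, and their flows come from
    [picard_lindelof].  The orbit is built in two halves that start at the midpoint of
    [a] and [b].  The half on [y <= 0] comes from shooting: followed backwards in time
    with initial velocity [q], a solution that starts slowly turns back before reaching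
    [b], one that starts fast runs past [b], both sets of velocities are open, and the
    interval of velocities is connected.  So some velocity does neither, and a
    Lyapunov function shows that its solution tends to [b] ([saddle_shooting],
    [saddle_decay]).
    The half on [y >= 0] has energy strictly below [V b], so it is trapped
    in the well ([trapped_in_well]), and a perturbed energy that decreases strictly off
    the equilibrium forces it to [a] ([well_convergence]).

    Non-monotonicity ([underdamped_connection_non_monotone]).  A monotone orbit would
    satisfy [P > a] throughout.  The hypothesis says that the linearisation at [a] has
    complex eigenvalues, and Sturm comparison with a sine excludes solutions of one sign
    on a whole half line ([oscillating_not_positive]). *)

(** * Global flow of a Lipschitz field *)

Fixpoint picard {V : CompleteNormedModule R_AbsRing} (X : V -> V) (x0 : V) (n : nat) : R -> V :=
  match n with
  | O => fun _ => x0
  | S m => fun t => plus x0 (RInt (fun s => X (picard X x0 m s)) 0 t)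
  end.

Lemma minus_plus_plus_l (G : AbelianGroup) (x u v : G) :
  minus (plus x u) (plus x v) = minus u v.
Proof.
  unfold minus. rewrite opp_plus, (plus_comm x u), <- plus_assoc.
  rewrite (plus_assoc x), plus_opp_r, plus_zero_l. reflexivity.
Qed.

(** The elementary facts on norms are stated at complete modules, so that the norms in
    the Picard estimates are all formed with the same projections and can be compared
    by linear arithmetic. *)
Lemma norm_minus_diag {V : CompleteNormedModule R_AbsRing} (x : V) : norm (minus x x) = 0.
Proof.
  assert (H : minus x x = zero)
    by exact (plus_opp_r (G := CompleteNormedModule.AbelianGroup _ V) x).
  rewrite H. exact (norm_zero (V := CompleteNormedModule.NormedModule _ V)).
Qed.

Lemma norm_minus_eq_0 {V : CompleteNormedModule R_AbsRing} (x y : V) :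
  norm (minus x y) = 0 -> x = y.
Proof.
  intros H. apply (plus_reg_r (G := CompleteNormedModule.AbelianGroup _ V) (opp y)).
  etransitivity; [exact (norm_eq_zero (V := CompleteNormedModule.NormedModule _ V) _ H)|].
  symmetry. apply (plus_opp_r (G := CompleteNormedModule.AbelianGroup _ V)).
Qed.

Lemma norm_minus_sym {V : CompleteNormedModule R_AbsRing} (x y : V) :
  norm (minus x y) = norm (minus y x).
Proof.
  assert (H : opp (minus x y) = minus y x)
    by exact (opp_minus (G := CompleteNormedModule.AbelianGroup _ V) x y).
  rewrite <- H. symmetry. exact (norm_opp (V := CompleteNormedModule.NormedModule _ V) _).
Qed.

Lemma norm_minus_triangle {V : CompleteNormedModule R_AbsRing} (y x z : V) :
  norm (minus x z) <= norm (minus x y) + norm (minus y z).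
Proof.
  assert (H : minus x z = plus (minus x y) (minus y z))
    by exact (minus_trans (G := CompleteNormedModule.AbelianGroup _ V) y x z).
  rewrite H. exact (norm_triangle (V := CompleteNormedModule.NormedModule _ V) _ _).
Qed.

Lemma filterlim_norm_minus {V : CompleteNormedModule R_AbsRing} {T : Type}
  {F : (T -> Prop) -> Prop} {FF : Filter F} (f : T -> V) (y : V) :
  filterlim f F (locally y) <-> forall eps : posreal, F (fun x => norm (minus (f x) y) < eps).
Proof.
  exact (filterlim_locally_ball_norm (U := CompleteNormedModule.NormedModule _ V) f y).
Qed.

Lemma lipschitz_continuous {U V : NormedModule R_AbsRing} (X : U -> V) (L : R) :
  0 < L -> (forall u v, norm (minus (X u) (X v)) <= L * norm (minus u v)) ->
  forall u, continuous X u.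
Proof.
  intros HL HX u. apply filterlim_locally_ball_norm. intros eps.
  assert (He : 0 < eps / L) by (apply Rdiv_lt_0_compat; [apply cond_pos | exact HL]).
  apply locally_le_locally_norm. exists (mkposreal _ He). intros v Hv.
  unfold ball_norm in *; simpl in Hv.
  apply Rle_lt_trans with (1 := HX v u).
  apply Rmult_lt_compat_l with (1 := HL) in Hv.
  replace (L * (eps / L)) with (pos eps) in Hv by (field; lra). exact Hv.
Qed.

Lemma is_derive_primitive {V : CompleteNormedModule R_AbsRing} (f : R -> V) (x0 : V) (a t : R) :
  (forall s, continuous f s) ->
  is_derive (fun t => plus x0 (RInt f a t)) t (f t).
Proof.
  intros Hf. rewrite <- (plus_zero_l (f t)).
  apply (is_derive_plus (fun _ => x0)); [apply (@is_derive_const R_AbsRing V)|].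
  apply is_derive_RInt with a; [|apply Hf].
  exists (mkposreal 1 Rlt_0_1). intros y _. apply RInt_correct, ex_RInt_continuous. auto.
Qed.

(** Integration gains a factor [1 / K] in the norm weighted by [exp (- K t)]: with
    [K = 2 L] the Picard map of an [L]-Lipschitz field becomes a contraction of ratio
    [1 / 2] on the whole half line at once. *)
Lemma norm_RInt_exp_le {V : CompleteNormedModule R_AbsRing} (f : R -> V) (D K t : R) :
  0 < K -> 0 <= D -> 0 <= t -> (forall s, continuous f s) ->
  (forall s, 0 <= s <= t -> norm (f s) <= D * exp (K * s)) ->
  norm (RInt f 0 t) <= D / K * exp (K * t).
Proof.
  intros HK HD Ht Hc Hf.
  assert (Hi : is_RInt (fun s => D * exp (K * s)) 0 t
                 (minus (D / K * exp (K * t)) (D / K * exp (K * 0)))).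
  { apply (is_RInt_derive (fun s => D / K * exp (K * s))).
    - intros s _. auto_derive; [trivial | field; lra].
    - intros s _. apply (ex_derive_continuous (V := R_NormedModule)). auto_derive; trivial. }
  assert (H := norm_RInt_le f _ 0 t _ _ Ht Hf
    (RInt_correct _ _ _ (ex_RInt_continuous f 0 t (fun z _ => Hc z))) Hi).
  apply Rle_trans with (1 := H). unfold minus, plus, opp; simpl.
  assert (0 <= D / K * exp (K * 0)).
  { apply Rmult_le_pos; [apply Rdiv_le_0_compat; lra | left; apply exp_pos]. }
  lra.
Qed.

Lemma picard_continuous {V : CompleteNormedModule R_AbsRing} (X : V -> V) (x0 : V) :
  (forall u, continuous X u) -> forall n t, continuous (picard X x0 n) t.
Proof.
  intros HX n. induction n as [|n IH]; intros t; simpl.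
  - apply continuous_const.
  - apply (ex_derive_continuous (K := R_AbsRing) (V := V)). eexists.
    apply (is_derive_primitive (fun s => X (picard X x0 n s))).
    intros s. apply continuous_comp; [apply IH | apply HX].
Qed.

Lemma picard_step {V : CompleteNormedModule R_AbsRing} (X : V -> V) (L : R) (x0 : V) :
  0 < L -> (forall u v, norm (minus (X u) (X v)) <= L * norm (minus u v)) ->
  forall n t, 0 <= t ->
  norm (minus (picard X x0 (S n) t) (picard X x0 n t))
    <= norm (X x0) / (2 * L) / 2 ^ n * exp (2 * L * t).
Proof.
  intros HL HX.
  assert (Hc := lipschitz_continuous X L HL HX).
  assert (HC : forall n s, continuous (fun s => X (picard X x0 n s)) s).
  { intros n s. apply continuous_comp; [apply picard_continuous, Hc | apply Hc]. }
  assert (Hp : forall n, 0 < 2 ^ n) by (intros; apply pow_lt; lra).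
  assert (Hm : forall u v : V, minus (plus x0 u) (plus x0 v) = minus u v)
    by (intros u v; exact (minus_plus_plus_l (CompleteNormedModule.AbelianGroup _ V) x0 u v)).
  induction n as [|n IH]; intros t Ht.
  - simpl. replace (minus (plus x0 (RInt (fun _ => X x0) 0 t)) x0) with (RInt (fun _ => X x0) 0 t).
    2:{ rewrite <- (plus_zero_r x0) at 2. rewrite Hm. symmetry. exact (minus_zero_r (G := CompleteNormedModule.AbelianGroup _ V) _). }
    rewrite Rdiv_1_r. apply norm_RInt_exp_le; try lra; [apply norm_ge_0 | apply (HC O) |].
    intros s Hs. rewrite <- (Rmult_1_r (norm (X x0))) at 1.
    apply Rmult_le_compat_l; [apply norm_ge_0|].
    rewrite <- exp_0 at 1. destruct (Rle_lt_or_eq_dec 0 s (proj1 Hs)) as [H|H].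
    + left; apply exp_increasing; nra.
    + rewrite <- H, Rmult_0_r. lra.
  - change (picard X x0 (S (S n)) t)
      with (plus x0 (RInt (fun s => X (picard X x0 (S n) s)) 0 t)).
    change (picard X x0 (S n) t) with (plus x0 (RInt (fun s => X (picard X x0 n s)) 0 t)) at 1.
    rewrite Hm, <- RInt_minus; try (apply ex_RInt_continuous; intros; apply HC).
    eapply Rle_trans; [apply (norm_RInt_exp_le _ (L * (norm (X x0) / (2 * L) / 2 ^ n)) (2 * L))|].
    + lra.
    + apply Rmult_le_pos; [lra|]. repeat apply Rdiv_le_0_compat; try lra; auto. apply norm_ge_0.
    + exact Ht.
    + intros s. apply @continuous_minus; apply HC.
    + intros s Hs. apply Rle_trans with (1 := HX _ _). rewrite Rmult_assoc.
      apply Rmult_le_compat_l; [lra|]. apply IH; lra.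
    + right. simpl. field. split; [lra|]. apply Rgt_not_eq, Hp.
Qed.

Lemma picard_cauchy {V : CompleteNormedModule R_AbsRing} (X : V -> V) (L : R) (x0 : V) :
  0 < L -> (forall u v, norm (minus (X u) (X v)) <= L * norm (minus u v)) ->
  forall n m t, 0 <= t ->
  norm (minus (picard X x0 (n + m) t) (picard X x0 n t))
    <= norm (X x0) / L / 2 ^ n * exp (2 * L * t).
Proof.
  intros HL HX n m t Ht.
  assert (Hp : forall n, 0 < 2 ^ n) by (intros; apply pow_lt; lra).
  set (C := norm (X x0) / L).
  assert (HC : 0 <= C * exp (2 * L * t)).
  { apply Rmult_le_pos; [apply Rdiv_le_0_compat; [apply norm_ge_0 | lra] | left; apply exp_pos]. }
  assert (H : norm (minus (picard X x0 (n + m) t) (picard X x0 n t))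
     <= C * exp (2 * L * t) * (/ 2 ^ n - / 2 ^ (n + m))).
  { induction m as [|m IH].
    - rewrite Nat.add_0_r. rewrite norm_minus_diag. lra.
    - rewrite Nat.add_succ_r.
      assert (Ht2 := norm_minus_triangle (picard X x0 (n + m) t)
        (picard X x0 (S (n + m)) t) (picard X x0 n t)).
      assert (Hs := picard_step X L x0 HL HX (n + m) t Ht).
      replace (norm (X x0) / (2 * L) / 2 ^ (n + m) * exp (2 * L * t))
        with (C * exp (2 * L * t) * (/ 2 ^ (n + m) - / 2 ^ (S (n + m)))) in Hs.
      2:{ unfold C; simpl. field. split; [lra | apply Rgt_not_eq, Hp]. }
      lra. }
  apply Rle_trans with (1 := H).
  assert (0 < / 2 ^ (n + m)) by apply Rinv_0_lt_compat, Hp.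
  unfold Rdiv. nra.
Qed.

Lemma is_lim_seq_geom_half (C : R) : is_lim_seq (fun n => C / 2 ^ n) 0.
Proof.
  replace (Finite 0) with (Rbar_mult C 0) by (simpl; f_equal; ring).
  apply is_lim_seq_ext with (fun n => C * (/ 2) ^ n).
  { intros n. rewrite pow_inv. reflexivity. }
  apply is_lim_seq_scal_l, is_lim_seq_geom. rewrite Rabs_pos_eq; lra.
Qed.

Lemma lt_of_geom_half (C eps : R) : 0 < eps -> exists n : nat, C / 2 ^ n < eps.
Proof.
  intros He. assert (H := is_lim_seq_geom_half C). apply is_lim_seq_spec in H.
  destruct (H (mkposreal _ He)) as [n Hn]. exists n. specialize (Hn n (le_n n)). simpl in Hn.
  rewrite Rminus_0_r in Hn. apply Rle_lt_trans with (2 := Hn), Rle_abs.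
Qed.

(** The limit is selected by [iota], the unique-description operator of complete modules. *)
Lemma picard_limit {V : CompleteNormedModule R_AbsRing} (X : V -> V) (L : R) (x0 : V) :
  0 < L -> (forall u v, norm (minus (X u) (X v)) <= L * norm (minus u v)) ->
  exists x : R -> V, forall t, 0 <= t -> forall n,
    norm (minus (x t) (picard X x0 n t)) <= norm (X x0) / L / 2 ^ n * exp (2 * L * t).
Proof.
  intros HL HX.
  exists (fun t => iota (fun l => filterlim (fun n => picard X x0 n t) eventually (locally l))).
  intros t Ht n.
  assert (Hex : exists l, filterlim (fun n => picard X x0 n t) eventually (locally l)).
  { apply (filterlim_locally_cauchy (U := CompleteNormedModule.CompleteSpace _ V)). intros eps.
    destruct (lt_of_geom_half (2 * (norm (X x0) / L * exp (2 * L * t))) eps (cond_pos eps))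
      as [N HN].
    exists (fun m => (N <= m)%nat). split; [exists N; auto|].
    intros u v Hu Hv. apply (norm_compat1 (V := V)).
    apply Rle_lt_trans with (1 := norm_minus_triangle (picard X x0 N t) _ _).
    rewrite (norm_minus_sym (picard X x0 N t)).
    replace u with (N + (u - N))%nat by lia. replace v with (N + (v - N))%nat by lia.
    assert (H1 := picard_cauchy X L x0 HL HX N (u - N) t Ht).
    assert (H2 := picard_cauchy X L x0 HL HX N (v - N) t Ht).
    replace (2 * (norm (X x0) / L * exp (2 * L * t)) / 2 ^ N)
      with (2 * (norm (X x0) / L / 2 ^ N * exp (2 * L * t))) in HN
      by (field; split; [lra | apply pow_nonzero; lra]).
    lra. }
  destruct Hex as [l Hl]. rewrite (iota_filterlim_locally _ _ Hl).
  apply Rnot_lt_le; intros Habs.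
  assert (Hd : 0 < norm (minus l (picard X x0 n t))
      - norm (X x0) / L / 2 ^ n * exp (2 * L * t)) by lra.
  destruct (proj1 (filterlim_norm_minus _ _) Hl (mkposreal _ Hd)) as [N HN].
  specialize (HN (n + N)%nat ltac:(lia)). simpl in HN.
  assert (H1 := picard_cauchy X L x0 HL HX n N t Ht).
  assert (H2 := norm_minus_triangle (picard X x0 (n + N) t) l (picard X x0 n t)).
  rewrite (norm_minus_sym l (picard X x0 (n + N) t)) in H2. lra.
Qed.

Lemma exp_le_mono (x y : R) : x <= y -> exp x <= exp y.
Proof.
  intros [H|H]; [left; apply exp_increasing, H | rewrite H; apply Rle_refl].
Qed.

(** Orbits are assembled below from two half-line solutions; the derivative at [0] is
    two-sided, which lets the halves be glued there. *)
Theorem picard_lindelof {V : CompleteNormedModule R_AbsRing} (X : V -> V) (L : R) (x0 : V) :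
  0 < L -> (forall u v, norm (minus (X u) (X v)) <= L * norm (minus u v)) ->
  exists x : R -> V, x 0 = x0 /\ forall t, 0 <= t -> is_derive x t (X (x t)).
Proof.
  intros HL HX.
  assert (Hc := lipschitz_continuous X L HL HX).
  assert (Hp : forall n, 0 < 2 ^ n) by (intros; apply pow_lt; lra).
  assert (Hm : forall u v : V, minus (plus x0 u) (plus x0 v) = minus u v)
    by (intros u v; exact (minus_plus_plus_l (CompleteNormedModule.AbelianGroup _ V) x0 u v)).
  destruct (picard_limit X L x0 HL HX) as [x Hx].
  set (C := norm (X x0) / L) in *.
  assert (HC : 0 <= C) by (apply Rdiv_le_0_compat; [apply norm_ge_0 | lra]).
  set (xr := fun t => x (Rmax 0 t)).
  assert (Hxc : forall t, continuous xr t).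
  { intros t. apply filterlim_norm_minus. intros eps.
    destruct (lt_of_geom_half (3 * (C * exp (2 * L * (Rmax 0 t + 1)))) eps (cond_pos eps))
      as [n Hn].
    assert (Hb : forall s, Rmax 0 s <= Rmax 0 t + 1 ->
       norm (minus (xr s) (picard X x0 n (Rmax 0 s))) < eps / 3).
    { intros s Hs. eapply Rle_lt_trans; [apply Hx, Rmax_l|].
      apply Rle_lt_trans with (C / 2 ^ n * exp (2 * L * (Rmax 0 t + 1))).
      - apply Rmult_le_compat_l; [apply Rdiv_le_0_compat; auto|].
        apply exp_le_mono. nra.
      - apply Rmult_lt_reg_l with 3; [lra|].
        replace (3 * (eps / 3)) with (pos eps) by field.
        apply Rle_lt_trans with (2 := Hn). right. field. apply Rgt_not_eq, Hp. }
    assert (He : 0 < eps / 3) by (generalize (cond_pos eps); lra).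
    assert (Hcn : continuous (fun s => picard X x0 n (Rmax 0 s)) t).
    { apply (continuous_comp (fun s => Rmax 0 s) (picard X x0 n)).
      - apply (lipschitz_continuous (U := R_NormedModule) (V := R_NormedModule) _ 1 Rlt_0_1).
        intros u v. unfold norm, minus, plus, opp; simpl. unfold abs; simpl.
        unfold Rabs, Rmax; repeat destruct Rcase_abs; repeat destruct Rle_dec; lra.
      - apply picard_continuous, Hc. }
    generalize (proj1 (filterlim_norm_minus _ _) Hcn (mkposreal _ He)).
    assert (Hl1 : locally t (fun s => Rmax 0 s <= Rmax 0 t + 1)).
    { exists (mkposreal 1 Rlt_0_1). intros s Hs. apply Rabs_def2 in Hs.
      unfold minus, plus, opp in Hs; simpl in Hs. unfold Rmax; repeat destruct Rle_dec; lra. }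
    intros Hl2. generalize (filter_and _ _ Hl1 Hl2). apply filter_imp. intros s [Hs1 Hs2].
    simpl in Hs2.
    assert (H1 := Hb s Hs1).
    assert (H2 := Hb t ltac:(lra)). rewrite norm_minus_sym in H2.
    assert (H3 := norm_minus_triangle (picard X x0 n (Rmax 0 s)) (xr s) (xr t)).
    assert (H4 := norm_minus_triangle (picard X x0 n (Rmax 0 t))
                    (picard X x0 n (Rmax 0 s)) (xr t)).
    lra. }
  assert (HXc : forall t, continuous (fun s => X (xr s)) t).
  { intros t. apply continuous_comp; [apply Hxc | apply Hc]. }
  (* the integral, unlike the pointwise limit [x], is differentiable on both sides of 0 *)
  exists (fun t => plus x0 (RInt (fun s => X (xr s)) 0 t)).
  split; [rewrite RInt_point, plus_zero_r; reflexivity|].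
  intros t Ht.
  replace (X (plus x0 (RInt (fun s => X (xr s)) 0 t))) with (X (xr t)).
  { apply (is_derive_primitive (fun s => X (xr s))), HXc. }
  f_equal.
  assert (Hxt : forall s, 0 <= s -> forall n,
    norm (minus (xr s) (picard X x0 n s)) <= C / 2 ^ n * exp (2 * L * s)).
  { intros s Hs n. unfold xr. rewrite Rmax_right by exact Hs. apply Hx, Hs. }
  set (z := plus x0 (RInt (fun s => X (xr s)) 0 t)).
  (* both sides are limits of [picard X x0 (S n) t] *)
  assert (Hn : forall n, norm (minus (xr t) z) <= C * exp (2 * L * t) / 2 ^ n).
  { intros n.
    apply Rle_trans with (1 := norm_minus_triangle (picard X x0 (S n) t) _ _).
    assert (H1 := Hxt t Ht (S n)).
    assert (H2 : norm (minus z (picard X x0 (S n) t)) <= C / 2 ^ (S n) * exp (2 * L * t)).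
    { unfold z; simpl.
      rewrite Hm, <- RInt_minus.
      2:{ apply ex_RInt_continuous. intros; apply HXc. }
      2:{ apply ex_RInt_continuous. intros; apply continuous_comp;
            [apply picard_continuous, Hc | apply Hc]. }
      eapply Rle_trans; [apply (norm_RInt_exp_le _ (L * (C / 2 ^ n)) (2 * L))|].
      - lra.
      - apply Rmult_le_pos; [lra|]. apply Rdiv_le_0_compat; auto.
      - exact Ht.
      - intros s. apply @continuous_minus; [apply HXc|]. apply continuous_comp;
          [apply picard_continuous, Hc | apply Hc].
      - intros s Hs. apply Rle_trans with (1 := HX _ _). rewrite Rmult_assoc.
        apply Rmult_le_compat_l; [lra|]. apply Hxt; lra.
      - right. simpl. field. split; [apply Rgt_not_eq, Hp | lra]. }
    rewrite norm_minus_sym in H2.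
    replace (C * exp (2 * L * t) / 2 ^ n) with (2 * (C / 2 ^ (S n) * exp (2 * L * t)))
      by (simpl; field; apply Rgt_not_eq, Hp). lra. }
  destruct (Rle_lt_dec (norm (minus (xr t) z)) 0) as [H0|H0].
  - apply norm_minus_eq_0, Rle_antisym; [exact H0 | apply (norm_ge_0 (V := V))].
  - destruct (lt_of_geom_half (C * exp (2 * L * t)) _ H0) as [n H1].
    specialize (Hn n). lra.
Qed.

(** * The second-order equation in the phase plane *)

Lemma mvt_lt (f df : R -> R) (a b : R) :
  a < b -> (forall t, a <= t <= b -> is_derive f t (df t)) ->
  exists c, a < c < b /\ f b - f a = df c * (b - a).
Proof.
  intros Hab Hd. destruct (MVT_cor2 f df a b Hab) as [c [Hc He]].
  - intros t Ht. apply is_derive_Reals, Hd, Ht.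
  - exists c; auto.
Qed.

Lemma derive_ge_growth (f df : R -> R) (a b m : R) :
  a <= b -> (forall t, a <= t <= b -> is_derive f t (df t)) ->
  (forall t, a <= t <= b -> m <= df t) -> f a + m * (b - a) <= f b.
Proof.
  intros [Hab|Hab] Hd Hm; [|rewrite Hab; lra].
  destruct (mvt_lt f df a b Hab Hd) as [c [Hc He]].
  specialize (Hm c ltac:(lra)). nra.
Qed.

Lemma derive_le_growth (f df : R -> R) (a b m : R) :
  a <= b -> (forall t, a <= t <= b -> is_derive f t (df t)) ->
  (forall t, a <= t <= b -> df t <= m) -> f b <= f a + m * (b - a).
Proof.
  intros [Hab|Hab] Hd Hm; [|rewrite Hab; lra].
  destruct (mvt_lt f df a b Hab Hd) as [c [Hc He]].
  specialize (Hm c ltac:(lra)). nra.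
Qed.

(** The equation [P'' = G P + al P'].  Damping is [al < 0]; the same equation followed
    backwards in time has [al > 0]. *)
Definition phase_curve (G : R -> R) (al : R) (P Q : R -> R) : Prop :=
  forall t, 0 <= t -> is_derive P t (Q t) /\ is_derive Q t (G (P t) + al * Q t).

Definition lipschitz (L : R) (G : R -> R) : Prop :=
  forall x y, Rabs (G x - G y) <= L * Rabs (x - y).

Lemma is_derive_fst (f : R -> C_R_CompleteNormedModule) (t : R) (l : C_R_CompleteNormedModule) :
  is_derive f t l -> is_derive (fun t => fst (f t)) t (fst l).
Proof.
  intros H.
  assert (H2 := filterdiff_comp' f (fun z : prod_NormedModule R_AbsRing R_NormedModule R_NormedModule => fst z) t _ _ H
    (filterdiff_linear _ is_linear_fst)).
  exact H2.
Qed.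

Lemma is_derive_snd (f : R -> C_R_CompleteNormedModule) (t : R) (l : C_R_CompleteNormedModule) :
  is_derive f t l -> is_derive (fun t => snd (f t)) t (snd l).
Proof.
  intros H.
  assert (H2 := filterdiff_comp' f (fun z : prod_NormedModule R_AbsRing R_NormedModule R_NormedModule => snd z) t _ _ H
    (filterdiff_linear _ is_linear_snd)).
  exact H2.
Qed.

(** The phase plane is the complete module [C], that is [R * R] with the product norm. *)
Lemma phase_curve_exists (G : R -> R) (L al p q : R) :
  0 < L -> lipschitz L G ->
  exists P Q, P 0 = p /\ Q 0 = q /\ phase_curve G al P Q.
Proof.
  intros HL HG.
  set (X := fun z : R * R => (snd z, G (fst z) + al * snd z) : R * R).
  destruct (picard_lindelof (V := C_R_CompleteNormedModule) X (2 * (1 + L + Rabs al)) (p, q))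
    as [z [Hz0 Hz]].
  - assert (H := Rabs_pos al). lra.
  - intros [u1 u2] [v1 v2].
    assert (H1 := proj2 (norm_prod (U := R_NormedModule) (V := R_NormedModule)
       (u2 - v2) ((G u1 + al * u2) - (G v1 + al * v2)))).
    assert (H2 : Rmax (Rabs (u1 - v1)) (Rabs (u2 - v2))
        <= norm ((u1 - v1, u2 - v2) : C_R_NormedModule))
      by exact (proj1 (norm_prod (U := R_NormedModule) (V := R_NormedModule)
       (u1 - v1) (u2 - v2))).
    change (norm ((u2 - v2, G u1 + al * u2 - (G v1 + al * v2)) : C_R_NormedModule)
       <= 2 * (1 + L + Rabs al) * norm ((u1 - v1, u2 - v2) : C_R_NormedModule)).
    apply Rle_trans with (1 := H1).
    change (norm (u1 - v1)) with (Rabs (u1 - v1)) in *.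
    change (norm (u2 - v2)) with (Rabs (u2 - v2)) in *.
    change (norm (G u1 + al * u2 - (G v1 + al * v2)))
      with (Rabs (G u1 + al * u2 - (G v1 + al * v2))) in *.
    set (N := norm ((u1 - v1, u2 - v2) : C_R_NormedModule)) in *.
    assert (Hs : sqrt 2 <= 2).
    { rewrite <- (sqrt_square 2) at 2 by lra. apply sqrt_le_1; lra. }
    assert (Ha := Rabs_pos al).
    assert (H3 := Rmax_l (Rabs (u1 - v1)) (Rabs (u2 - v2))).
    assert (H4 := Rmax_r (Rabs (u1 - v1)) (Rabs (u2 - v2))).
    assert (H5 := Rabs_pos (u1 - v1)).
    assert (HA := Rabs_pos (u2 - v2)). assert (H0 : 0 <= N) by lra.
    assert (HN := Rmult_le_pos _ _ (Rlt_le _ _ HL) H0). assert (HN2 := Rmult_le_pos _ _ Ha H0).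
    rewrite Rmult_assoc. apply Rmult_le_compat; auto using sqrt_pos.
    + apply Rle_trans with (2 := Rmax_l _ _), Rabs_pos.
    + apply Rmax_lub; [nra|].
      replace (G u1 + al * u2 - (G v1 + al * v2)) with ((G u1 - G v1) + al * (u2 - v2)) by ring.
      apply Rle_trans with (1 := Rabs_triang _ _). rewrite Rabs_mult.
      assert (H6 := HG u1 v1). nra.
  - exists (fun t => fst (z t)), (fun t => snd (z t)).
    rewrite Hz0. split; [reflexivity | split; [reflexivity|]]. intros t Ht. split.
    + exact (is_derive_fst z t _ (Hz t Ht)).
    + exact (is_derive_snd z t _ (Hz t Ht)).
Qed.

(** The squared distance [D] of two solutions satisfies [D' <= K D] with the constant of
    the exponent. *)
Lemma phase_curve_gronwall (G : R -> R) (L al : R) (P1 Q1 P2 Q2 : R -> R) :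
  0 < L -> lipschitz L G -> phase_curve G al P1 Q1 -> phase_curve G al P2 Q2 ->
  forall t, 0 <= t ->
  (P1 t - P2 t) ^ 2 + (Q1 t - Q2 t) ^ 2
    <= ((P1 0 - P2 0) ^ 2 + (Q1 0 - Q2 0) ^ 2) * exp ((1 + L + 2 * Rabs al) * t).
Proof.
  intros HL HG H1 H2 t Ht.
  set (K := 1 + L + 2 * Rabs al).
  set (D := fun t => (P1 t - P2 t) ^ 2 + (Q1 t - Q2 t) ^ 2).
  set (dD := fun t => 2 * (P1 t - P2 t) * (Q1 t - Q2 t)
    + 2 * (Q1 t - Q2 t) * ((G (P1 t) + al * Q1 t) - (G (P2 t) + al * Q2 t))).
  assert (Hd : forall s, 0 <= s ->
    is_derive (fun s => D s * exp (- K * s)) s ((dD s - K * D s) * exp (- K * s))).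
  { intros s Hs. destruct (H1 s Hs) as [Ha Hb], (H2 s Hs) as [Hc He]. unfold D.
    auto_derive; [repeat split; eexists; eauto|].
    replace (Derive (fun x => P1 x) s) with (Q1 s) by (symmetry; apply is_derive_unique, Ha).
    replace (Derive (fun x => P2 x) s) with (Q2 s) by (symmetry; apply is_derive_unique, Hc).
    replace (Derive (fun x => Q1 x) s) with (G (P1 s) + al * Q1 s) by (symmetry; apply is_derive_unique, Hb).
    replace (Derive (fun x => Q2 x) s) with (G (P2 s) + al * Q2 s) by (symmetry; apply is_derive_unique, He).
    unfold dD. ring. }
  assert (Hle : forall s, 0 <= s -> (dD s - K * D s) * exp (- K * s) <= 0).
  { intros s Hs. assert (He := exp_pos (- K * s)).
    enough (dD s <= K * D s) by nra. unfold dD, D, K.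
    assert (HGs := HG (P1 s) (P2 s)). set (p := P1 s - P2 s) in *. set (q := Q1 s - Q2 s) in *.
    set (g := G (P1 s) - G (P2 s)) in *.
    replace (G (P1 s) + al * Q1 s - (G (P2 s) + al * Q2 s)) with (g + al * q) by (unfold g, q; ring).
    assert (Hqg : 2 * q * g <= L * (p ^ 2 + q ^ 2)).
    { apply Rle_trans with (2 * (Rabs q * (L * Rabs p))).
      - apply Rle_trans with (2 * (Rabs q * Rabs g)).
        + rewrite <- Rabs_mult. generalize (Rle_abs (q * g)). lra.
        + apply Rmult_le_compat_l; [lra|]. apply Rmult_le_compat_l; auto using Rabs_pos.
      - rewrite <- (pow2_abs p), <- (pow2_abs q).
        assert (0 <= L * (Rabs p - Rabs q) ^ 2) by (apply Rmult_le_pos; [lra | apply pow2_ge_0]).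
        lra. }
    assert (Hal := Rle_abs al). assert (Hal0 := Rabs_pos al).
    assert (H0p := pow2_ge_0 p). assert (H0q := pow2_ge_0 q). assert (H0pq := pow2_ge_0 (p - q)).
    nra. }
  assert (Hf := derive_le_growth _ _ 0 t 0 Ht (fun s Hs => Hd s (proj1 Hs)) (fun s Hs => Hle s (proj1 Hs))).
  simpl in Hf. rewrite Rmult_0_r, exp_0 in Hf. fold (D t). fold (D 0).
  replace (D t) with (D t * exp (- K * t) * exp (K * t)).
  - apply Rmult_le_compat_r; [left; apply exp_pos | lra].
  - rewrite Rmult_assoc, <- exp_plus. replace (- K * t + K * t) with 0 by ring.
    rewrite exp_0; ring.
Qed.

(** * The unstable branch of the hill: shooting backwards *)

Lemma is_derive_continuity_pt (f : R -> R) (t l : R) : is_derive f t l -> continuity_pt f t.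
Proof.
  intros H. apply continuity_pt_filterlim, (ex_derive_continuous (V := R_NormedModule)).
  exists l; exact H.
Qed.

Lemma ivt_between (f : R -> R) (a b y : R) :
  a <= b -> (forall t, a <= t <= b -> continuity_pt f t) ->
  f a <= y <= f b \/ f b <= y <= f a -> exists t, a <= t <= b /\ f t = y.
Proof.
  intros Hab Hc Hy.
  destruct (Req_dec (f a) y) as [Ha|Ha]; [exists a; lra|].
  destruct (Req_dec (f b) y) as [Hb|Hb]; [exists b; lra|].
  assert (Hab' : a < b) by (destruct Hab as [H|H]; [exact H | subst b; lra]).
  destruct Hy as [Hy|Hy].
  - destruct (IVT_interv (fun t => f t - y) a b) as [t [Ht1 Ht2]]; try lra.
    + intros t Ht. apply continuity_pt_minus; [apply Hc, Ht | apply continuity_pt_const; intros ? ?; reflexivity].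
    + exists t; split; [exact Ht1 | lra].
  - destruct (IVT_interv (fun t => y - f t) a b) as [t [Ht1 Ht2]]; try lra.
    + intros t Ht. apply continuity_pt_minus; [apply continuity_pt_const; intros ? ?; reflexivity | apply Hc, Ht].
    + exists t; split; [exact Ht1 | lra].
Qed.

Lemma pos_lower_bound (g : R -> R) (u v : R) :
  (forall x, u <= x <= v -> continuity_pt g x) -> (forall x, u <= x <= v -> 0 < g x) ->
  exists m, 0 < m /\ forall x, u <= x <= v -> m <= g x.
Proof.
  intros Hc Hg. destruct (Rle_lt_dec u v) as [Huv|Huv].
  - destruct (continuity_ab_min g u v Huv Hc) as [x [Hx1 Hx2]].
    exists (g x). split; [apply Hg, Hx2 | exact Hx1].
  - exists 1. split; [lra | intros x Hx; lra].
Qed.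

Lemma lipschitz_continuity (L : R) (G : R -> R) (x : R) :
  0 < L -> lipschitz L G -> continuity_pt G x.
Proof.
  intros HL HG. apply continuity_pt_filterlim.
  apply (lipschitz_continuous (U := R_NormedModule) (V := R_NormedModule) G L HL HG).
Qed.

Lemma continuity_pt_eps (f : R -> R) (x eps : R) :
  continuity_pt f x -> 0 < eps ->
  exists d, 0 < d /\ forall y, Rabs (y - x) < d -> Rabs (f y - f x) < eps.
Proof.
  intros Hf He. destruct (proj1 (continuity_pt_locally f x) Hf (mkposreal _ He)) as [d Hd].
  exists d. split; [apply cond_pos | exact Hd].
Qed.

Lemma is_lim_p_infty_intro (f : R -> R) (l : R) :
  (forall eps, 0 < eps -> exists T, forall t, T <= t -> Rabs (f t - l) < eps) ->
  is_lim f p_infty l.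
Proof.
  intros H. apply is_lim_spec. intros eps. destruct (H eps (cond_pos eps)) as [T HT].
  exists T. intros t Ht. apply HT. lra.
Qed.

(** Connectedness of a segment, by the supremum of the part lying in [A]. *)
Lemma not_covered_by_two_open (A B : R -> Prop) (u v : R) :
  u <= v -> open A -> open B -> (forall q, A q -> B q -> False) -> A u -> B v ->
  exists q, u <= q <= v /\ ~ A q /\ ~ B q.
Proof.
  intros Huv HA HB HAB HAu HBv.
  destruct (completeness (fun q => u <= q <= v /\ A q)) as [m [Hm1 Hm2]].
  { exists v. intros q Hq; lra. }
  { exists u. split; [lra | exact HAu]. }
  assert (Hmv : m <= v) by (apply Hm2; intros q Hq; lra).
  assert (Hum : u <= m) by (apply Hm1; split; [lra | exact HAu]).
  exists m. split; [lra|]. split; intros Hm.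
  - assert (Hlt : m < v) by (destruct Hmv as [H|H]; [exact H | subst; exfalso; eauto]).
    destruct (HA m Hm) as [d Hd]. assert (Hdp := cond_pos d).
    assert (H1 := Rmin_l (d / 2) (v - m)). assert (H2 := Rmin_r (d / 2) (v - m)).
    assert (H3 : 0 < Rmin (d / 2) (v - m)) by (apply Rmin_glb_lt; lra).
    set (e := Rmin _ _) in *.
    assert (H4 : A (m + e)).
    { apply Hd. change (Rabs (m + e - m) < d). rewrite Rabs_pos_eq; lra. }
    assert (H5 : u <= m + e <= v) by lra.
    specialize (Hm1 (m + e) (conj H5 H4)). lra.
  - destruct (HB m Hm) as [d Hd]. assert (Hdp := cond_pos d).
    assert (H : m <= m - d / 2); [|lra].
    apply Hm2. intros q [Hq HAq]. apply Rnot_lt_le. intros Hlt.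
    apply (HAB q HAq), Hd. change (Rabs (q - m) < d).
    assert (H := Hm1 q (conj Hq HAq)). apply Rabs_def1; lra.
Qed.

(** Above the level [m] the function cannot decrease, because
    [(r - m) exp (- c t)] is nondecreasing. *)
Lemma outward_growth (c m : R) (r dr : R -> R) (a b : R) :
  0 < c -> a <= b -> (forall t, a <= t <= b -> is_derive r t (dr t)) ->
  (forall t, a <= t <= b -> c * (r t - m) <= dr t) -> m <= r a -> r a <= r b.
Proof.
  intros Hc Hab Hd Hg Hm.
  assert (H := derive_ge_growth (fun t => (r t - m) * exp (- c * t))
    (fun t => (dr t - c * (r t - m)) * exp (- c * t)) a b 0 Hab).
  assert (H1 : (r a - m) * exp (- c * a) <= (r b - m) * exp (- c * b)).
  { rewrite Rmult_0_l, Rplus_0_r in H. apply H.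
    - intros t Ht. auto_derive; [exists (dr t); auto|].
      replace (Derive (fun x => r x) t) with (dr t) by (symmetry; apply is_derive_unique, Hd, Ht).
      ring.
    - intros t Ht. apply Rmult_le_pos; [specialize (Hg t Ht); lra | left; apply exp_pos]. }
  assert (H2 : exp (- c * b) <= exp (- c * a)) by (apply exp_le_mono; nra).
  assert (H3 := exp_pos (- c * b)). nra.
Qed.

(** The force of a hill at [0]: it points away from [0] everywhere. *)
Definition repelling (psi : R -> R) : Prop := forall x, x <> 0 -> 0 < x * psi x.

Lemma repelling_nonneg (psi : R -> R) : repelling psi -> forall x, 0 <= x * psi x.
Proof.
  intros Hpsi x. destruct (Req_dec x 0) as [->|H]; [lra | left; apply Hpsi, H].
Qed.

(** The product of position and velocity drives the analysis of the hill: for a repelling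
    [psi] the first two terms are nonnegative, so once this product is positive the solution
    moves away from the hill top for ever. *)
Lemma product_derive (psi : R -> R) (c : R) (x r : R -> R) (t : R) :
  phase_curve psi c x r -> 0 <= t ->
  is_derive (fun t => x t * r t) t (r t ^ 2 + x t * psi (x t) + c * (x t * r t)).
Proof.
  intros Hs Ht. destruct (Hs t Ht) as [H1 H2].
  auto_derive; [split; [eexists; exact H1 | split; [eexists; exact H2 | trivial]]|].
  replace (Derive (fun x0 => x x0) t) with (r t) by (symmetry; apply is_derive_unique, H1).
  replace (Derive (fun x0 => r x0) t) with (psi (x t) + c * r t)
    by (symmetry; apply is_derive_unique, H2).
  ring.
Qed.

Lemma product_stays_positive (psi : R -> R) (c : R) (x r : R -> R) (s t : R) :
  0 < c -> repelling psi ->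
  phase_curve psi c x r -> 0 <= s <= t -> 0 < x s * r s -> 0 < x t * r t.
Proof.
  intros Hc Hpsi Hs Hst Hpos.
  apply Rlt_le_trans with (1 := Hpos).
  apply (outward_growth c 0 (fun t => x t * r t)
    (fun t => r t ^ 2 + x t * psi (x t) + c * (x t * r t)) s t Hc (proj2 Hst)).
  - intros u Hu. apply product_derive; [exact Hs | lra].
  - intros u Hu. simpl.
    assert (H := repelling_nonneg psi Hpsi (x u)). assert (H' := pow2_ge_0 (r u)). simpl in H'. lra.
  - lra.
Qed.

Definition reaches (psi : R -> R) (c x0 : R) (U : R -> R -> Prop) (q : R) : Prop :=
  exists x r t, x 0 = x0 /\ r 0 = q /\ phase_curve psi c x r /\ 0 <= t /\ U (x t) (r t).

(** Continuous dependence on the initial velocity, by the Gronwall estimate. *)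
Lemma reaches_open (psi : R -> R) (L c x0 : R) (U : R -> R -> Prop) :
  0 < L -> lipschitz L psi ->
  (forall x r, U x r -> exists d, 0 < d /\
     forall x' r', Rabs (x' - x) < d -> Rabs (r' - r) < d -> U x' r') ->
  open (reaches psi c x0 U).
Proof.
  intros HL Hlip HU q [x [r [t [Hx [Hr [Hs [Ht Hxr]]]]]]].
  destruct (HU _ _ Hxr) as [d [Hd Hd']].
  set (K := exp ((1 + L + 2 * Rabs c) * t)).
  assert (HK : 1 <= K).
  { rewrite <- exp_0. apply exp_le_mono, Rmult_le_pos; [|exact Ht].
    assert (H := Rabs_pos c). lra. }
  assert (He : 0 < d / K) by (apply Rdiv_lt_0_compat; lra).
  exists (mkposreal _ He). intros q' Hq'. change (Rabs (q' - q) < d / K) in Hq'.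
  destruct (phase_curve_exists psi L c x0 q' HL Hlip) as [x' [r' [Hx' [Hr' Hs']]]].
  exists x', r', t. split; [exact Hx'|]. split; [exact Hr'|]. split; [exact Hs'|].
  split; [exact Ht|].
  assert (HG := phase_curve_gronwall psi L c x' r' x r HL Hlip Hs' Hs t Ht). fold K in HG.
  rewrite Hx, Hr, Hx', Hr' in HG.
  assert (Hb : (x' t - x t) ^ 2 + (r' t - r t) ^ 2 < d ^ 2).
  { apply Rle_lt_trans with (1 := HG).
    replace ((x0 - x0) ^ 2 + (q' - q) ^ 2) with (Rabs (q' - q) ^ 2) by (rewrite pow2_abs; ring).
    assert (Ha := Rabs_pos (q' - q)).
    assert (H1 : Rabs (q' - q) * K < d).
    { replace d with (d / K * K) by (field; lra). apply Rmult_lt_compat_r; lra. }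
    assert (H2 : Rabs (q' - q) <= Rabs (q' - q) * K) by nra.
    nra. }
  destruct (triangle_rectangle_lt (x' t - x t) (r' t - r t) d) as [H1 H2].
  { unfold Rsqr. lra. }
  rewrite (Rabs_pos_eq d) in H1, H2 by lra. apply Hd'; assumption.
Qed.

(** Retreating and having passed the top exclude each other: between the two times the
    position would vanish, while the product of position and velocity stays positive. *)
Lemma no_crossing (psi : R -> R) (c : R) (x r : R -> R) (s t : R) :
  0 < c -> repelling psi -> phase_curve psi c x r ->
  0 <= s -> 0 <= t -> x s < 0 -> r s < 0 -> 0 < x t -> 0 < r t -> False.
Proof.
  intros Hc Hpsi Hs Hs0 Ht0 Hxs Hrs Hxt Hrt.
  assert (Hz : exists u, Rmin s t <= u <= Rmax s t /\ x u = 0).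
  { destruct (Rle_lt_dec s t) as [H|H].
    - rewrite Rmin_left, Rmax_right by lra. apply ivt_between; [lra | | lra].
      intros u Hu. apply is_derive_continuity_pt with (r u), Hs. lra.
    - rewrite Rmin_right, Rmax_left by lra. apply ivt_between; [lra | | lra].
      intros u Hu. apply is_derive_continuity_pt with (r u), Hs. lra. }
  destruct Hz as [u [Hu Hxu]].
  assert (H : 0 < x u * r u); [|rewrite Hxu in H; lra].
  apply (product_stays_positive psi c x r (Rmin s t)); auto.
  - split; [apply Rmin_glb; lra | lra].
  - unfold Rmin; destruct Rle_dec; nra.
Qed.

Lemma phase_curve_unique (psi : R -> R) (L c : R) (x r x' r' : R -> R) (t : R) :
  0 < L -> lipschitz L psi -> phase_curve psi c x r -> phase_curve psi c x' r' ->
  x 0 = x' 0 -> r 0 = r' 0 -> 0 <= t -> x t = x' t /\ r t = r' t.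
Proof.
  intros HL Hlip Hs Hs' Hx Hr Ht.
  assert (H := phase_curve_gronwall psi L c x r x' r' HL Hlip Hs Hs' t Ht).
  rewrite Hx, Hr in H.
  replace ((x' 0 - x' 0) ^ 2 + (r' 0 - r' 0) ^ 2) with 0 in H by ring.
  rewrite Rmult_0_l in H.
  assert (H1 := pow2_ge_0 (x t - x' t)). assert (H2 := pow2_ge_0 (r t - r' t)).
  split; apply Rminus_diag_uniq, Rsqr_0_uniq; unfold Rsqr; simpl in *; lra.
Qed.

(** Starting at rest the particle falls back ([x < 0], [r < 0]); starting with velocity
    [M / c + 1] it keeps velocity at least 1, since the anti-damping [c r] then beats the
    force, and runs over the top ([0 < x], [0 < r]).  Both outcomes are open in the velocity
    and exclude each other, so some velocity has neither, which says that the product of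
    position and velocity is never positive. *)
Lemma saddle_shooting (psi : R -> R) (L c M x0 : R) :
  0 < L -> lipschitz L psi -> 0 < c -> repelling psi ->
  0 < M -> (forall x, - M <= psi x) -> x0 < 0 ->
  exists x r, x 0 = x0 /\ phase_curve psi c x r /\ forall t, 0 <= t -> x t * r t <= 0.
Proof.
  intros HL Hlip Hc Hpsi HM0 HM Hx0.
  set (A := reaches psi c x0 (fun x r => x < 0 /\ r < 0)).
  set (B := reaches psi c x0 (fun x r => 0 < x /\ 0 < r)).
  destruct (not_covered_by_two_open A B 0 (M / c + 1)) as [q [Hq [HA HB]]].
  - assert (0 < M / c) by (apply Rdiv_lt_0_compat; lra). lra.
  - apply reaches_open with L; auto. intros x r [Hx Hr].
    exists (Rmin (- x) (- r)). split; [apply Rmin_glb_lt; lra|].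
    intros x' r' H1 H2. assert (H3 := Rmin_l (- x) (- r)). assert (H4 := Rmin_r (- x) (- r)).
    apply Rabs_def2 in H1, H2. lra.
  - apply reaches_open with L; auto. intros x r [Hx Hr].
    exists (Rmin x r). split; [apply Rmin_glb_lt; lra|].
    intros x' r' H1 H2. assert (H3 := Rmin_l x r). assert (H4 := Rmin_r x r).
    apply Rabs_def2 in H1, H2. lra.
  - intros q [x [r [s [Hx [Hr [Hs [Hs0 [H1 H2]]]]]]]] [x' [r' [t [Hx' [Hr' [Hs' [Ht0 [H3 H4]]]]]]]].
    destruct (phase_curve_unique psi L c x' r' x r t HL Hlip Hs' Hs) as [E1 E2]; try congruence.
    rewrite E1 in H3. rewrite E2 in H4.
    exact (no_crossing psi c x r s t Hc Hpsi Hs Hs0 Ht0 H1 H2 H3 H4).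
  - destruct (phase_curve_exists psi L c x0 0 HL Hlip) as [x [r [Hx [Hr Hs]]]].
    apply NNPP; intros Hno.
    (* [r' 0 = psi x0 < 0], so [r] is negative just after time 0, while [x] still is *)
    destruct (Hs 0 (Rle_refl 0)) as [H1 H2].
    assert (Hp : psi x0 < 0) by (assert (H := Hpsi x0 ltac:(lra)); nra).
    rewrite Hx, Hr, Rmult_0_r, Rplus_0_r in H2.
    apply is_derive_Reals in H2.
    destruct (H2 (- psi x0) ltac:(lra)) as [d Hd].
    destruct (continuity_pt_eps x 0 (- x0) (is_derive_continuity_pt _ _ _ H1) ltac:(lra))
      as [d' [Hd'0 Hd']].
    assert (Hdp := cond_pos d).
    assert (H3 : 0 < Rmin d d') by (apply Rmin_glb_lt; lra).
    assert (H4 := Rmin_l d d'). assert (H5 := Rmin_r d d').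
    set (e := Rmin d d') in *.
    specialize (Hd (e / 2) ltac:(lra) ltac:(rewrite Rabs_pos_eq; lra)).
    specialize (Hd' (e / 2) ltac:(rewrite Rabs_pos_eq; lra)).
    rewrite Hx in Hd'. rewrite Rplus_0_l, Hr, Rminus_0_r in Hd.
    apply Rabs_def2 in Hd, Hd'.
    apply Hno. exists x, r, (e / 2). split; [exact Hx|]. split; [exact Hr|].
    split; [exact Hs|]. split; [lra|]. split; [lra|].
    assert (Hlt : r (e / 2) / (e / 2) < 0) by lra.
    replace (r (e / 2)) with (r (e / 2) / (e / 2) * (e / 2)) by (field; lra). nra.
  - destruct (phase_curve_exists psi L c x0 (M / c + 1) HL Hlip) as [x [r [Hx [Hr Hs]]]].
    assert (Hmc : 0 < M / c) by (apply Rdiv_lt_0_compat; lra).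
    assert (Hr1 : forall t, 0 <= t -> 1 <= r t).
    { intros t Ht. assert (H := outward_growth c (M / c) r _ 0 t Hc Ht
        (fun u Hu => proj2 (Hs u (proj1 Hu)))). rewrite Hr in H.
      assert (M / c + 1 <= r t); [apply H; [|lra] | lra].
      intros u Hu. specialize (HM (x u)).
      replace (c * (r u - M / c)) with (c * r u - M) by (field; lra). lra. }
    exists x, r, (1 - x0). split; [exact Hx|]. split; [exact Hr|]. split; [exact Hs|].
    split; [lra|].
    assert (H := derive_ge_growth x r 0 (1 - x0) 1 ltac:(lra)
       (fun u Hu => proj1 (Hs u (proj1 Hu))) (fun u Hu => Hr1 u (proj1 Hu))).
    specialize (Hr1 (1 - x0) ltac:(lra)). lra.
  - destruct (phase_curve_exists psi L c x0 q HL Hlip) as [x [r [Hx [Hr Hs]]]].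
    exists x, r. split; [exact Hx|]. split; [exact Hs|]. intros t Ht.
    apply Rnot_lt_le. intros Hpos.
    destruct (Rlt_le_dec (x t) 0) as [Hneg|Hnn].
    + apply HA. exists x, r, t. split; [exact Hx|]. split; [exact Hr|]. split; [exact Hs|].
      split; [exact Ht|]. split; [exact Hneg | nra].
    + assert (Hxp : 0 < x t).
      { destruct Hnn as [H|H]; [exact H | rewrite <- H in Hpos; lra]. }
      apply HB. exists x, r, t. split; [exact Hx|]. split; [exact Hr|]. split; [exact Hs|].
      split; [exact Ht|]. split; [exact Hxp | nra].
Qed.

(** [x^2] is nonincreasing, and [J = x r - c x^2 / 2] is nonpositive with
    [J' = r^2 + x psi x].  If [x] stayed away from [0], [J'] would be bounded below and [J]
    would become positive.  The velocity follows, since a velocity that dominates the force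
    grows by anti-damping and would carry [x] out of its bounded range. *)
Lemma saddle_decay (psi : R -> R) (L c x0 : R) (x r : R -> R) :
  0 < L -> lipschitz L psi -> 0 < c -> repelling psi -> x0 < 0 ->
  x 0 = x0 -> phase_curve psi c x r -> (forall t, 0 <= t -> x t * r t <= 0) ->
  (forall t, 0 <= t -> x0 <= x t <= 0) /\ is_lim x p_infty 0 /\ is_lim r p_infty 0.
Proof.
  intros HL Hlip Hc Hpsi Hx0 Hx Hs Hxr.
  assert (Hcont : forall y, continuity_pt psi y) by (intros; apply lipschitz_continuity with L; auto).
  assert (Hsq : forall s t, 0 <= s <= t -> x t ^ 2 <= x s ^ 2).
  { intros s t Hst.
    assert (H := derive_le_growth (fun t => x t ^ 2) (fun t => 2 * (x t * r t)) s t 0 (proj2 Hst)).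
    rewrite Rmult_0_l, Rplus_0_r in H. apply H.
    - intros u Hu. destruct (Hs u ltac:(lra)) as [H1 _].
      auto_derive; [eexists; exact H1|].
      replace (Derive (fun x0 => x x0) u) with (r u) by (symmetry; apply is_derive_unique, H1). ring.
    - intros u Hu. specialize (Hxr u ltac:(lra)). lra. }
  assert (Hle0 : forall t, 0 <= t -> x t <= 0).
  { intros t Ht. apply Rnot_lt_le. intros Hpos.
    destruct (ivt_between x 0 t 0 Ht) as [s [Hs1 Hs2]].
    - intros u Hu. apply is_derive_continuity_pt with (r u), Hs. lra.
    - lra.
    - assert (H := Hsq s t Hs1). rewrite Hs2 in H. nra. }
  assert (Hge : forall t, 0 <= t -> x0 <= x t).
  { intros t Ht. assert (H := Hsq 0 t ltac:(lra)). assert (H' := Hle0 t Ht). rewrite Hx in H. nra. }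
  assert (Hlx : forall eps, 0 < eps -> exists T, 0 <= T /\ forall t, T <= t -> Rabs (x t) < eps).
  { intros eps He.
    assert (Hex : exists T, 0 <= T /\ - eps < x T).
    { apply NNPP. intros Hno.
      assert (Hall : forall t, 0 <= t -> x t <= - eps).
      { intros t Ht. apply Rnot_lt_le. intros Hlt. apply Hno. exists t; auto. }
      destruct (pos_lower_bound (fun y => y * psi y) x0 (- eps)) as [m [Hm0 Hm]].
      - intros y Hy. apply continuity_pt_mult; [apply derivable_continuous_pt, derivable_pt_id | apply Hcont].
      - intros y Hy. apply Hpsi. lra.
      - assert (HJ : forall t, 0 <= t ->
           is_derive (fun t => x t * r t - c * x t ^ 2 / 2) t (r t ^ 2 + x t * psi (x t))).
        { intros t Ht. destruct (Hs t Ht) as [H1 H2].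
          auto_derive; [repeat split; eexists; eassumption|].
          replace (Derive (fun x0 => x x0) t) with (r t) by (symmetry; apply is_derive_unique, H1).
          replace (Derive (fun x0 => r x0) t) with (psi (x t) + c * r t)
            by (symmetry; apply is_derive_unique, H2). field. }
        set (J := fun t => x t * r t - c * x t ^ 2 / 2) in *.
        set (t := (1 - J 0) / m).
        assert (HJneg : forall t, 0 <= t -> J t <= 0).
        { intros u Hu. specialize (Hxr u Hu). unfold J. assert (H := pow2_ge_0 (x u)). nra. }
        assert (Ht : 0 <= t).
        { apply Rdiv_le_0_compat; [|exact Hm0]. specialize (HJneg 0 (Rle_refl 0)). lra. }
        assert (H := derive_ge_growth J _ 0 t m Ht (fun u Hu => HJ u (proj1 Hu))).
        assert (J 0 + m * (t - 0) <= J t).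
        { apply H. intros u Hu. specialize (Hm (x u) (conj (Hge u (proj1 Hu)) (Hall u (proj1 Hu)))).
          simpl in Hm. assert (H' := pow2_ge_0 (r u)). lra. }
        replace (m * (t - 0)) with (1 - J 0) in H0 by (unfold t; field; lra).
        specialize (HJneg t Ht). lra. }
    destruct Hex as [T [HT0 HT]]. exists T. split; [exact HT0|]. intros t Ht.
    assert (H1 := Hsq T t (conj HT0 Ht)). assert (H2 := Hle0 T HT0).
    assert (H3 := Hle0 t ltac:(lra)). rewrite Rabs_left1 by exact H3. nra. }
  assert (Hpsi0 : psi 0 = 0).
  { (* [psi] changes sign at 0 *)
    apply NNPP. intros Hne.
    destruct (continuity_pt_eps psi 0 (Rabs (psi 0)) (Hcont 0) (Rabs_pos_lt _ Hne)) as [d [Hd0 Hd]].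
    assert (H1 := Hd (d / 2) ltac:(rewrite Rabs_pos_eq; lra)).
    assert (H2 := Hd (- (d / 2)) ltac:(rewrite Rabs_left; lra)).
    assert (H3 := Hpsi (d / 2) ltac:(lra)). assert (H4 := Hpsi (- (d / 2)) ltac:(lra)).
    assert (H5 : 0 < psi (d / 2)) by nra. assert (H6 : psi (- (d / 2)) < 0) by nra.
    apply Rabs_def2 in H1, H2. unfold Rabs in *; destruct Rcase_abs; lra. }
  split; [auto|]. split; apply is_lim_p_infty_intro; intros eps He.
  - destruct (Hlx eps He) as [T [_ HT]]. exists T. intros t Ht. rewrite Rminus_0_r. auto.
  - destruct (continuity_pt_eps psi 0 (c * eps / 3) (Hcont 0)) as [d [Hd0 Hd]].
    { assert (0 < c * eps) by (apply Rmult_lt_0_compat; lra). lra. }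
    destruct (Hlx d Hd0) as [T [HT0 HT]]. exists T. intros t Ht. rewrite Rminus_0_r.
    assert (Hsmall : forall u, T <= u -> Rabs (psi (x u)) < c * eps / 3).
    { intros u Hu. specialize (Hd (x u)). rewrite Hpsi0, !Rminus_0_r in Hd. apply Hd, HT, Hu. }
    (* were [|r t| >= eps], anti-damping would keep [r] away from 0 for ever *)
    set (t' := t + (1 - x0) / eps).
    assert (Ht' : t <= t').
    { unfold t'. assert (0 < (1 - x0) / eps) by (apply Rdiv_lt_0_compat; lra). lra. }
    assert (Hrange : - (1 - x0) < x t' - x t < 1 - x0).
    { assert (H1 := Hge t ltac:(lra)). assert (H2 := Hge t' ltac:(lra)).
      assert (H3 := Hle0 t ltac:(lra)). assert (H4 := Hle0 t' ltac:(lra)). lra. }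
    assert (Het : eps * (t' - t) = 1 - x0) by (unfold t'; field; lra).
    apply Rabs_def1; apply Rnot_le_lt; intros Hbad.
    + assert (Hr : forall u, t <= u -> eps <= r u).
      { intros u Hu. apply Rle_trans with (1 := Hbad).
        apply (outward_growth c (eps / 3) r _ t u Hc Hu (fun v Hv => proj2 (Hs v ltac:(lra)))); [|lra].
        intros v Hv. specialize (Hsmall v ltac:(lra)). apply Rabs_def2 in Hsmall. lra. }
      assert (H := derive_ge_growth x r t t' eps Ht'
        (fun v Hv => proj1 (Hs v ltac:(lra))) (fun v Hv => Hr v (proj1 Hv))). lra.
    + assert (Hr : forall u, t <= u -> r u <= - eps).
      { intros u Hu. apply Rle_trans with (2 := Hbad), Ropp_le_cancel.
        apply (outward_growth c (eps / 3) (fun v => - r v) (fun v => - (psi (x v) + c * r v)) t u Hc Hu).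
        - intros v Hv. apply (is_derive_opp (V := R_NormedModule) r), Hs. lra.
        - intros v Hv. specialize (Hsmall v ltac:(lra)). apply Rabs_def2 in Hsmall. lra.
        - lra. }
      assert (H := derive_le_growth x r t t' (- eps) Ht'
        (fun v Hv => proj1 (Hs v ltac:(lra))) (fun v Hv => Hr v (proj1 Hv))). lra.
Qed.

(** * The descent into the well *)

Lemma is_lim_p_infty_elim (f : R -> R) (l eps : R) :
  is_lim f p_infty l -> 0 < eps -> exists T, 0 <= T /\ forall t, T <= t -> Rabs (f t - l) < eps.
Proof.
  intros H He. apply is_lim_spec in H. destruct (H (mkposreal _ He)) as [T HT].
  exists (Rmax 0 (T + 1)). split; [apply Rmax_l|].
  intros t Ht. apply HT. assert (H1 := Rmax_r 0 (T + 1)). lra.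
Qed.

Definition energy (V P Q : R -> R) (t : R) : R := Q t ^ 2 / 2 + V (P t).

Lemma energy_derive (phi V : R -> R) (al : R) (P Q : R -> R) (t : R) :
  (forall x, is_derive V x (- phi x)) -> phase_curve phi al P Q -> 0 <= t ->
  is_derive (energy V P Q) t (al * Q t ^ 2).
Proof.
  intros HV Hs Ht. destruct (Hs t Ht) as [H1 H2]. unfold energy.
  auto_derive.
  - repeat split; try (eexists; eassumption). exists (- phi (P t)). apply HV.
  - replace (Derive (fun x => P x) t) with (Q t) by (symmetry; apply is_derive_unique, H1).
    replace (Derive (fun x => Q x) t) with (phi (P t) + al * Q t)
      by (symmetry; apply is_derive_unique, H2).
    replace (Derive (fun x => V x) (P t)) with (- phi (P t)) by (symmetry; apply is_derive_unique, HV).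
    field.
Qed.

(** [V] decreases up to [a] and increases after it. *)
Lemma potential_well (phi V : R -> R) (lo a hi : R) :
  (forall x, is_derive V x (- phi x)) ->
  (forall x, lo <= x < a -> 0 < phi x) -> (forall x, a < x <= hi -> phi x < 0) ->
  forall x, lo <= x <= hi -> x <> a -> V a < V x.
Proof.
  intros HV Hlo Hhi x Hx Hxa. destruct (Rlt_le_dec x a) as [H|H].
  - destruct (mvt_lt V (fun x => - phi x) x a H (fun t _ => HV t)) as [y [Hy E]].
    specialize (Hlo y ltac:(lra)). nra.
  - destruct (mvt_lt V (fun x => - phi x) a x ltac:(lra) (fun t _ => HV t)) as [y [Hy E]].
    specialize (Hhi y ltac:(lra)). nra.
Qed.

(** The energy does not increase, so [P] can never take the value [lo] or [hi], where the
    potential alone exceeds the initial energy. *)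
Lemma trapped_in_well (phi V : R -> R) (c lo hi : R) (P Q : R -> R) :
  0 < c -> (forall x, is_derive V x (- phi x)) -> phase_curve phi (- c) P Q ->
  lo < P 0 < hi -> energy V P Q 0 < V lo -> energy V P Q 0 < V hi ->
  forall t, 0 <= t -> lo < P t < hi.
Proof.
  intros Hc HV Hs HP0 Hlo Hhi.
  assert (HE : forall t, 0 <= t -> V (P t) <= energy V P Q 0).
  { intros t Ht.
    assert (H := derive_le_growth _ _ 0 t 0 Ht
      (fun u Hu => energy_derive phi V (- c) P Q u HV Hs (proj1 Hu))).
    assert (H0 : energy V P Q t <= energy V P Q 0 + 0 * (t - 0)).
    { apply H. intros u _. assert (H1 := pow2_ge_0 (Q u)). simpl in *. nra. }
    unfold energy at 1 in H0. assert (H1 := pow2_ge_0 (Q t)). lra. }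
  assert (HPc : forall t, 0 <= t -> forall u, 0 <= u <= t -> continuity_pt P u).
  { intros t Ht u Hu. apply is_derive_continuity_pt with (Q u), Hs, Hu. }
  intros t Ht. split; apply Rnot_le_lt; intros Hout.
  - destruct (ivt_between P 0 t lo Ht (HPc t Ht)) as [u [Hu E]]; [lra|].
    specialize (HE u (proj1 Hu)). rewrite E in HE. lra.
  - destruct (ivt_between P 0 t hi Ht (HPc t Ht)) as [u [Hu E]]; [lra|].
    specialize (HE u (proj1 Hu)). rewrite E in HE. lra.
Qed.

Lemma pos_lower_bound_off_point (g : R -> R) (lo a hi d : R) :
  0 < d -> (forall x, continuity_pt g x) -> (forall x, lo <= x <= hi -> x <> a -> 0 < g x) ->
  exists m, 0 < m /\ forall x, lo <= x <= hi -> d <= Rabs (x - a) -> m <= g x.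
Proof.
  intros Hd Hc Hg.
  destruct (pos_lower_bound g lo (Rmin hi (a - d))) as [m1 [Hm1 H1]].
  { intros; apply Hc. }
  { intros x Hx. assert (Ha := Rmin_l hi (a - d)). assert (Hb := Rmin_r hi (a - d)). apply Hg; lra. }
  destruct (pos_lower_bound g (Rmax lo (a + d)) hi) as [m2 [Hm2 H2]].
  { intros; apply Hc. }
  { intros x Hx. assert (Ha := Rmax_l lo (a + d)). assert (Hb := Rmax_r lo (a + d)). apply Hg; lra. }
  exists (Rmin m1 m2). split; [apply Rmin_glb_lt; assumption|].
  intros x Hx Hxd. destruct (Rle_lt_dec a x) as [H|H].
  - rewrite Rabs_pos_eq in Hxd by lra. apply Rle_trans with (1 := Rmin_r _ _), H2.
    split; [apply Rmax_lub; lra | lra].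
  - rewrite Rabs_left in Hxd by lra. apply Rle_trans with (1 := Rmin_l _ _), H1.
    split; [lra | apply Rmin_glb; lra].
Qed.

(** The energy is only known to decrease by [c Q^2], which vanishes at turning points.
    Adding [c / 2 ((P - a) Q + c / 2 (P - a)^2)] gives a function [W], still bounded below
    by [V a], with [W' = - c / 2 (Q^2 - (P - a) phi P)], which is strictly negative off the
    equilibrium.  So the energy comes arbitrarily close to [V a], and stays close to it
    because it is monotone. *)
Lemma well_convergence (phi V : R -> R) (c lo a hi : R) (P Q : R -> R) :
  0 < c -> (forall x, continuity_pt phi x) -> (forall x, is_derive V x (- phi x)) ->
  phase_curve phi (- c) P Q -> lo < a < hi ->
  (forall x, lo <= x < a -> 0 < phi x) -> (forall x, a < x <= hi -> phi x < 0) ->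
  (forall t, 0 <= t -> lo < P t < hi) ->
  is_lim P p_infty a /\ is_lim Q p_infty 0.
Proof.
  intros Hc Hcont HV Hs Ha Hlo Hhi HP.
  assert (Hmin := potential_well phi V lo a hi HV Hlo Hhi).
  assert (Hmin' : forall t, 0 <= t -> V a <= V (P t)).
  { intros t Ht. destruct (Req_dec (P t) a) as [->|H]; [lra|].
    left. apply Hmin; [specialize (HP t Ht); lra | exact H]. }
  assert (HVc : forall x, continuity_pt V x)
    by (intros x; apply is_derive_continuity_pt with (- phi x), HV).
  set (E := energy V P Q).
  assert (HEdec : forall s t, 0 <= s <= t -> E t <= E s).
  { intros s t Hst.
    assert (H := derive_le_growth E _ s t 0 (proj2 Hst)
      (fun u Hu => energy_derive phi V (- c) P Q u HV Hs (Rle_trans _ _ _ (proj1 Hst) (proj1 Hu)))).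
    rewrite Rmult_0_l, Rplus_0_r in H. apply H. intros u _.
    assert (H1 := pow2_ge_0 (Q u)). simpl in *. nra. }
  set (N := fun t => Q t ^ 2 - (P t - a) * phi (P t)).
  set (W := fun t => E t + c / 2 * ((P t - a) * Q t + c / 2 * (P t - a) ^ 2)).
  assert (HW : forall t, 0 <= t -> is_derive W t (- (c / 2) * N t)).
  { intros t Ht. destruct (Hs t Ht) as [H1 H2].
    assert (H3 := energy_derive phi V (- c) P Q t HV Hs Ht). fold E in H3.
    unfold W. auto_derive; [repeat split; eexists; eassumption|].
    replace (Derive (fun x => P x) t) with (Q t) by (symmetry; apply is_derive_unique, H1).
    replace (Derive (fun x => Q x) t) with (phi (P t) + - c * Q t)
      by (symmetry; apply is_derive_unique, H2).
    replace (Derive (fun x => E x) t) with (- c * Q t ^ 2) by (symmetry; apply is_derive_unique, H3).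
    unfold N. field. }
  assert (HWlow : forall t, 0 <= t -> V a <= W t).
  { intros t Ht. unfold W, E, energy. specialize (Hmin' t Ht).
    assert (H1 := pow2_ge_0 (Q t + c / 2 * (P t - a))). assert (H2 := pow2_ge_0 (c * (P t - a))).
    nra. }
  assert (Hphi : forall t, 0 <= t -> 0 <= - ((P t - a) * phi (P t))).
  { intros t Ht. specialize (HP t Ht). destruct (Rtotal_order (P t) a) as [H|[H|H]].
    - specialize (Hlo (P t) ltac:(lra)). nra.
    - rewrite H. lra.
    - specialize (Hhi (P t) ltac:(lra)). nra. }
  assert (HElim : forall e, 0 < e -> exists T, 0 <= T /\ forall t, T <= t -> E t < V a + e).
  { intros e He.
    assert (Hex : exists T, 0 <= T /\ E T < V a + e).
    { apply NNPP. intros Hno.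
      assert (Hall : forall t, 0 <= t -> V a + e <= E t).
      { intros t Ht. apply Rnot_lt_le. intros Hlt. apply Hno. exists t; auto. }
      destruct (continuity_pt_eps V a (e / 2) (HVc a) ltac:(lra)) as [d [Hd0 Hd]].
      destruct (pos_lower_bound_off_point (fun x => - ((x - a) * phi x)) lo a hi d Hd0)
        as [m [Hm0 Hm]].
      { intros x. apply continuity_pt_opp, continuity_pt_mult; [|apply Hcont].
        apply continuity_pt_minus;
          [apply derivable_continuous_pt, derivable_pt_id
          | apply continuity_pt_const; intros ? ?; reflexivity]. }
      { intros x Hx Hxa. destruct (Rlt_le_dec x a) as [H|H].
        - specialize (Hlo x ltac:(lra)). nra.
        - specialize (Hhi x ltac:(lra)). nra. }
      assert (HN : forall t, 0 <= t -> Rmin m e <= N t).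
      { intros t Ht. destruct (Rle_lt_dec d (Rabs (P t - a))) as [H|H].
        - apply Rle_trans with (1 := Rmin_l _ _). specialize (HP t Ht).
          assert (H1 := Hm (P t) ltac:(lra) H). assert (H2 := pow2_ge_0 (Q t)).
          unfold N. lra.
        - apply Rle_trans with (1 := Rmin_r _ _). specialize (Hall t Ht). specialize (Hphi t Ht).
          assert (H1 := Hd _ H). apply Rabs_def2 in H1. unfold E, energy in Hall. unfold N. lra. }
      assert (Hk : 0 < Rmin m e) by (apply Rmin_glb_lt; assumption).
      set (k := Rmin m e) in *.
      set (t := (W 0 - V a + 1) / (c / 2 * k)).
      assert (Hck : 0 < c / 2 * k) by (apply Rmult_lt_0_compat; lra).
      assert (Ht : 0 <= t).
      { apply Rdiv_le_0_compat; [|exact Hck]. specialize (HWlow 0 (Rle_refl 0)). lra. }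
      assert (H := derive_le_growth W _ 0 t (- (c / 2 * k)) Ht (fun u Hu => HW u (proj1 Hu))).
      assert (H1 : W t <= W 0 + - (c / 2 * k) * (t - 0)).
      { apply H. intros u Hu. specialize (HN u (proj1 Hu)). simpl. nra. }
      replace (- (c / 2 * k) * (t - 0)) with (- (W 0 - V a + 1)) in H1
        by (unfold t; field; split; lra).
      specialize (HWlow t Ht). lra. }
    destruct Hex as [T [HT0 HT]]. exists T. split; [exact HT0|]. intros t Ht.
    specialize (HEdec T t (conj HT0 Ht)). lra. }
  split; apply is_lim_p_infty_intro; intros eps He.
  - destruct (pos_lower_bound_off_point (fun x => V x - V a) lo a hi eps He) as [m [Hm0 Hm]].
    { intros x. apply continuity_pt_minus; [apply HVc|].
      apply continuity_pt_const; intros ? ?; reflexivity. }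
    { intros x Hx Hxa. specialize (Hmin x Hx Hxa). lra. }
    destruct (HElim m Hm0) as [T [HT0 HT]]. exists T. intros t Ht. apply Rnot_le_lt. intros Hbad.
    specialize (HP t ltac:(lra)). specialize (Hm (P t) ltac:(lra) Hbad). specialize (HT t Ht).
    unfold E, energy in HT. assert (H := pow2_ge_0 (Q t)). lra.
  - destruct (HElim (eps ^ 2 / 2)) as [T [HT0 HT]].
    { assert (0 < eps ^ 2) by (apply pow_lt; lra). lra. }
    exists T. intros t Ht. rewrite Rminus_0_r.
    specialize (HT t Ht). specialize (Hmin' t ltac:(lra)). unfold E, energy in HT.
    rewrite <- (Rabs_pos_eq eps) by lra. apply Rsqr_lt_abs_0. unfold Rsqr. lra.
Qed.

Definition clamp (lo hi x : R) : R := Rmax lo (Rmin hi x).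

Lemma clamp_in (lo hi x : R) : lo <= hi -> lo <= clamp lo hi x <= hi.
Proof. intros H. unfold clamp, Rmax, Rmin; repeat destruct Rle_dec; lra. Qed.

Lemma clamp_id (lo hi x : R) : lo <= x <= hi -> clamp lo hi x = x.
Proof. intros H. unfold clamp, Rmax, Rmin; repeat destruct Rle_dec; lra. Qed.

Lemma clamp_lipschitz (lo hi : R) : lipschitz 1 (clamp lo hi).
Proof.
  intros x y. unfold clamp, Rmax, Rmin, Rabs;
    repeat destruct Rle_dec; repeat destruct Rcase_abs; lra.
Qed.

Lemma lipschitz_clamp (phi : R -> R) (L lo hi : R) :
  0 < L -> lo <= hi ->
  (forall x y, lo <= x <= hi -> lo <= y <= hi -> Rabs (phi x - phi y) <= L * Rabs (x - y)) ->
  lipschitz L (fun x => phi (clamp lo hi x)).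
Proof.
  intros HL Hle H x y. apply Rle_trans with (1 := H _ _ (clamp_in lo hi x Hle) (clamp_in lo hi y Hle)).
  apply Rmult_le_compat_l; [lra|]. assert (H1 := clamp_lipschitz lo hi x y). lra.
Qed.

(** Both functions are meant to agree at [0]. *)
Definition glue (f g : R -> R) (y : R) : R := if Rle_dec y 0 then f y else g y.

Lemma glue_nonpos (f g : R -> R) (y : R) : y <= 0 -> glue f g y = f y.
Proof. intros H. unfold glue. destruct Rle_dec; [reflexivity | lra]. Qed.

Lemma glue_nonneg (f g : R -> R) (y : R) : f 0 = g 0 -> 0 <= y -> glue f g y = g y.
Proof.
  intros H0 H. unfold glue. destruct Rle_dec; [|reflexivity].
  replace y with 0 by lra. exact H0.
Qed.

Lemma glue_derive (f g df dg : R -> R) :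
  f 0 = g 0 -> df 0 = dg 0 ->
  (forall y, y <= 0 -> is_derive f y (df y)) -> (forall y, 0 <= y -> is_derive g y (dg y)) ->
  forall y, is_derive (glue f g) y (glue df dg y).
Proof.
  intros H0 Hd0 Hf Hg y. destruct (Rtotal_order y 0) as [Hy|[Hy|Hy]].
  - rewrite glue_nonpos by lra. apply is_derive_ext_loc with f; [|apply Hf; lra].
    assert (Hp : 0 < - y) by lra. exists (mkposreal _ Hp). intros z Hz.
    apply Rabs_def2 in Hz. unfold minus, plus, opp in Hz; simpl in Hz.
    symmetry. apply glue_nonpos. lra.
  - subst y. rewrite glue_nonpos by lra. apply is_derive_Reals. intros eps He.
    destruct (proj1 (is_derive_Reals _ _ _) (Hf 0 (Rle_refl 0)) eps He) as [d1 H1].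
    destruct (proj1 (is_derive_Reals _ _ _) (Hg 0 (Rle_refl 0)) eps He) as [d2 H2].
    assert (Hd : 0 < Rmin d1 d2) by (apply Rmin_glb_lt; apply cond_pos).
    exists (mkposreal _ Hd). intros h Hh0 Hh. simpl in Hh.
    assert (Ha := Rmin_l d1 d2). assert (Hb := Rmin_r d1 d2).
    rewrite (glue_nonpos f g 0) by lra. destruct (Rle_lt_dec h 0) as [Hn|Hp].
    + rewrite glue_nonpos by lra. apply H1; [exact Hh0 | lra].
    + rewrite glue_nonneg by (exact H0 || lra). rewrite H0, Hd0. apply H2; [exact Hh0 | lra].
  - rewrite glue_nonneg by (exact Hd0 || lra). apply is_derive_ext_loc with g; [|apply Hg; lra].
    exists (mkposreal _ Hy). intros z Hz.
    apply Rabs_def2 in Hz. unfold minus, plus, opp in Hz; simpl in Hz.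
    symmetry. apply glue_nonneg; [exact H0 | lra].
Qed.

(** The integral condition is the inequality [V b <= V eta] between the heights of the hill
    and of the wall opposite to it. *)
Theorem damped_heteroclinic_exists (phi : R -> R) (L c eta a b : R) :
  0 < c -> 0 < L -> eta < a < b ->
  (forall x y, eta <= x <= b -> eta <= y <= b -> Rabs (phi x - phi y) <= L * Rabs (x - y)) ->
  phi a = 0 -> phi b = 0 ->
  (forall x, eta <= x < a -> 0 < phi x) -> (forall x, a < x < b -> phi x < 0) ->
  0 <= RInt phi eta b ->
  exists P Q : R -> R,
    (forall y, is_derive P y (Q y) /\ is_derive Q y (phi (P y) - c * Q y)) /\
    (forall y, eta < P y) /\
    is_lim P m_infty b /\ is_lim Q m_infty 0 /\ is_lim P p_infty a /\ is_lim Q p_infty 0.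
Proof.
  intros Hc HL Hab Hlip Hphia Hphib Hpos Hneg Hint.
  set (d := (a + b) / 2).
  assert (Hd : a < d < b) by (unfold d; lra).
  (* Backwards in time and in the variable [x = P - b], the equation is [x'' = phi (b + x) + c x'].
     Clamping to [d, b] and adding the positive part of [x] makes the force Lipschitz
     and repelling on the whole line. *)
  set (psi := fun x => phi (clamp d b (b + x)) + Rmax 0 x).
  assert (Hpsi_lip : lipschitz (L + 1) psi).
  { assert (H := lipschitz_clamp phi L d b HL ltac:(lra)
      (fun x y Hx Hy => Hlip x y ltac:(lra) ltac:(lra))).
    intros x y. specialize (H (b + x) (b + y)).
    replace (b + x - (b + y)) with (x - y) in H by ring.
    assert (H1 : Rabs (Rmax 0 x - Rmax 0 y) <= Rabs (x - y)).
    { unfold Rmax, Rabs; repeat destruct Rle_dec; repeat destruct Rcase_abs; lra. }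
    unfold psi. simpl in H.
    replace (phi (clamp d b (b + x)) + Rmax 0 x - (phi (clamp d b (b + y)) + Rmax 0 y))
      with ((phi (clamp d b (b + x)) - phi (clamp d b (b + y))) + (Rmax 0 x - Rmax 0 y)) by ring.
    apply Rle_trans with (1 := Rabs_triang _ _). lra. }
  assert (Hrep : repelling psi).
  { intros x Hx. unfold psi. destruct (Rle_lt_dec x 0) as [H|H].
    - rewrite Rmax_left by lra.
      assert (Hin := clamp_in d b (b + x) ltac:(lra)).
      assert (clamp d b (b + x) < b)
        by (unfold clamp, Rmax, Rmin; repeat destruct Rle_dec; lra).
      specialize (Hneg (clamp d b (b + x)) ltac:(lra)). nra.
    - rewrite Rmax_right by lra.
      replace (clamp d b (b + x)) with b
        by (unfold clamp, Rmax, Rmin; repeat destruct Rle_dec; lra).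
      rewrite Hphib. nra. }
  assert (HM : 0 < L * (b - d)) by (apply Rmult_lt_0_compat; lra).
  assert (Hbelow : forall x, - (L * (b - d)) <= psi x).
  { intros x. unfold psi. assert (H1 := Rmax_l 0 x).
    assert (Hin := clamp_in d b (b + x) ltac:(lra)). set (u := clamp _ _ _) in *.
    assert (H2 := Hlip u b ltac:(lra) ltac:(lra)). rewrite Hphib, Rminus_0_r in H2.
    rewrite (Rabs_left1 (u - b)) in H2 by lra.
    assert (H3 : - Rabs (phi u) <= phi u) by (unfold Rabs; destruct Rcase_abs; lra). nra. }
  destruct (saddle_shooting psi (L + 1) c (L * (b - d)) (d - b)) as [x [r [Hx0 [Hxs Hxr]]]];
    try assumption; try lra.
  destruct (saddle_decay psi (L + 1) c (d - b) x r) as [Hxin [Hxlim Hrlim]];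
    try assumption; try lra.
  assert (Hpsi_eq : forall t, 0 <= t -> psi (x t) = phi (b + x t)).
  { intros t Ht. specialize (Hxin t Ht). unfold psi.
    rewrite clamp_id, Rmax_left by lra. ring. }
  (* for [y >= 0] the field is only changed outside [eta, b], where the trapped orbit never goes *)
  set (phic := fun y => phi (clamp eta b y)).
  assert (Hphic_eq : forall y, eta <= y <= b -> phic y = phi y).
  { intros y Hy. unfold phic. rewrite clamp_id; auto. }
  assert (Hphic_lip : lipschitz L phic) by (apply lipschitz_clamp; auto; lra).
  assert (Hphic_c : forall y, continuity_pt phic y)
    by (intros; apply lipschitz_continuity with L; auto).
  assert (Hphic_i : forall u v, ex_RInt phic u v).
  { intros u v. apply (ex_RInt_continuous (V := R_CompleteNormedModule)).
    intros z _. apply continuity_pt_filterlim, Hphic_c. }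
  set (V := fun y => - RInt phic a y).
  assert (HV : forall y, is_derive V y (- phic y)).
  { intros y. unfold V. apply (is_derive_opp (V := R_NormedModule) (fun y => RInt phic a y)).
    apply (is_derive_RInt (V := R_NormedModule) phic _ a).
    - exists (mkposreal 1 Rlt_0_1). intros z _.
      apply (RInt_correct (V := R_CompleteNormedModule)), Hphic_i.
    - apply continuity_pt_filterlim, Hphic_c. }
  assert (HVc : forall y, continuity_pt V y)
    by (intros y; apply is_derive_continuity_pt with (- phic y), HV).
  assert (HVeta : V b <= V eta).
  { assert (H1 := RInt_Chasles (V := R_CompleteNormedModule) phic a eta b (Hphic_i _ _) (Hphic_i _ _)).
    assert (H2 : RInt phic eta b = RInt phi eta b).
    { apply (RInt_ext (V := R_CompleteNormedModule)). intros y Hy.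
      rewrite Rmin_left, Rmax_right in Hy by lra. apply Hphic_eq. lra. }
    unfold plus in H1; simpl in H1. unfold V. lra. }
  destruct (phase_curve_exists phic L (- c) d (- r 0) HL Hphic_lip) as [P2 [Q2 [HP0 [HQ0 Hs2]]]].
  assert (He0 : energy V P2 Q2 0 < V b).
  { set (e := energy V (fun t => b + x t) r).
    assert (Hes : phase_curve phic c (fun t => b + x t) r).
    { intros t Ht. destruct (Hxs t Ht) as [H1 H2]. split.
      - auto_derive; [eexists; exact H1|].
        replace (Derive (fun x0 => x x0) t) with (r t) by (symmetry; apply is_derive_unique, H1). ring.
      - rewrite Hpsi_eq in H2 by exact Ht. rewrite Hphic_eq; [exact H2|].
        specialize (Hxin t Ht). lra. }
    assert (Hde : forall t, 0 <= t -> is_derive e t (c * r t ^ 2))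
      by (intros t Ht; apply energy_derive with phic; auto).
    assert (Hle : forall s, 0 <= s -> e s <= V b).
    { intros s Hs. apply Rnot_lt_le. intros Hlt.
      destruct (continuity_pt_eps V b ((e s - V b) / 2) (HVc b) ltac:(lra)) as [d1 [Hd1 Hd1']].
      destruct (is_lim_p_infty_elim x 0 d1 Hxlim Hd1) as [T1 [HT1 HT1']].
      assert (Hm : 0 < Rmin 1 (e s - V b)) by (apply Rmin_glb_lt; lra).
      destruct (is_lim_p_infty_elim r 0 _ Hrlim Hm) as [T2 [HT2 HT2']].
      set (t := Rmax s (Rmax T1 T2)).
      assert (Ht1 := Rmax_l s (Rmax T1 T2)). assert (Ht2 := Rmax_r s (Rmax T1 T2)).
      assert (Ht3 := Rmax_l T1 T2). assert (Ht4 := Rmax_r T1 T2). fold t in Ht1, Ht2.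
      specialize (HT1' t ltac:(lra)). specialize (HT2' t ltac:(lra)).
      rewrite Rminus_0_r in HT1', HT2'.
      assert (H1 := Hd1' (b + x t)). replace (b + x t - b) with (x t) in H1 by ring.
      specialize (H1 HT1'). apply Rabs_def2 in H1.
      assert (H2 : r t ^ 2 <= Rabs (r t)).
      { rewrite <- pow2_abs. assert (H3 := Rmin_l 1 (e s - V b)). assert (H4 := Rabs_pos (r t)). nra. }
      assert (H3 := Rmin_r 1 (e s - V b)).
      assert (H4 := derive_ge_growth e _ s t 0 Ht1 (fun u Hu => Hde u ltac:(lra))).
      assert (H5 : e s + 0 * (t - s) <= e t).
      { apply H4. intros u _. assert (H6 := pow2_ge_0 (r u)). simpl in *. nra. }
      unfold e at 2, energy in H5. lra. }
    (* Strictness: subtracting [c m (2 x - m t)] from [e] leaves the derivative [c (r - m)^2 >= 0],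
       so with [m] the mean velocity, [e] grows by at least [c m^2 t]. *)
    destruct (is_lim_p_infty_elim x 0 ((b - d) / 2) Hxlim ltac:(lra)) as [T [HT0 HT]].
    specialize (HT (T + 1) ltac:(lra)). rewrite Rminus_0_r in HT. apply Rabs_def2 in HT.
    set (t := T + 1) in *. assert (Ht : 0 < t) by (unfold t; lra).
    set (m := (x t - (d - b)) / t).
    assert (Hm : 0 < m) by (apply Rdiv_lt_0_compat; lra).
    assert (Hgain : e 0 + c * m * m * t <= e t).
    { assert (H := derive_ge_growth (fun t => e t - c * m * (2 * x t - m * t))
        (fun t => c * (r t - m) ^ 2) 0 t 0 ltac:(lra)).
      rewrite Rmult_0_l, Rplus_0_r in H.
      assert (H1 : e 0 - c * m * (2 * x 0 - m * 0) <= e t - c * m * (2 * x t - m * t)).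
      { apply H.
        - intros u Hu. assert (E1 := Hde u (proj1 Hu)). destruct (Hxs u (proj1 Hu)) as [E2 _].
          auto_derive; [repeat split; eexists; eassumption|].
          replace (Derive (fun x0 => x x0) u) with (r u) by (symmetry; apply is_derive_unique, E2).
          replace (Derive (fun x0 => e x0) u) with (c * r u ^ 2) by (symmetry; apply is_derive_unique, E1).
          ring.
        - intros u _. apply Rmult_le_pos; [lra | apply pow2_ge_0]. }
      rewrite Hx0 in H1.
      assert (Hxt : x t = d - b + m * t) by (unfold m; field; lra).
      rewrite Hxt in H1. lra. }
    clearbody m.
    assert (0 < c * m * m * t) by (repeat apply Rmult_lt_0_compat; lra).
    specialize (Hle t ltac:(lra)).
    replace (energy V P2 Q2 0) with (e 0); [lra|].
    unfold e, energy. rewrite HP0, HQ0, Hx0. replace (b + (d - b)) with d by ring. field. }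
  (* the well is cut off before [b], where the force vanishes, so that [a] is its only equilibrium *)
  assert (Hhi : exists hi, d < hi < b /\ energy V P2 Q2 0 < V hi).
  { destruct (continuity_pt_eps V b (V b - energy V P2 Q2 0) (HVc b) ltac:(lra)) as [e [He He']].
    exists (Rmax ((d + b) / 2) (b - e / 2)).
    assert (H1 := Rmax_l ((d + b) / 2) (b - e / 2)). assert (H2 := Rmax_r ((d + b) / 2) (b - e / 2)).
    assert (H3 : Rmax ((d + b) / 2) (b - e / 2) < b) by (apply Rmax_lub_lt; lra).
    split; [lra|].
    specialize (He' (Rmax ((d + b) / 2) (b - e / 2)) ltac:(rewrite Rabs_left; lra)).
    apply Rabs_def2 in He'. lra. }
  destruct Hhi as [hi [Hhi1 Hhi2]].
  assert (Htrap : forall t, 0 <= t -> eta < P2 t < hi).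
  { apply trapped_in_well with phic V c Q2; auto; [rewrite HP0 |]; lra. }
  destruct (well_convergence phic V c eta a hi P2 Q2) as [HP2lim HQ2lim]; auto; try lra.
  { intros y Hy. rewrite Hphic_eq by lra. apply Hpos, Hy. }
  { intros y Hy. rewrite Hphic_eq by lra. apply Hneg. lra. }
  set (P1 := fun y => b + x (- y)). set (Q1 := fun y => - r (- y)).
  assert (E0 : P1 0 = P2 0) by (unfold P1; rewrite Ropp_0, Hx0, HP0; ring).
  assert (E1 : Q1 0 = Q2 0) by (unfold Q1; rewrite Ropp_0, HQ0; reflexivity).
  exists (glue P1 P2), (glue Q1 Q2).
  split; [intros y; split|].
  - apply glue_derive; auto.
    + intros z Hz. unfold P1, Q1. destruct (Hxs (- z) ltac:(lra)) as [H1 _].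
      auto_derive; [eexists; exact H1|].
      replace (Derive (fun x0 => x x0) (- z)) with (r (- z)) by (symmetry; apply is_derive_unique, H1).
      ring.
    + intros z Hz. apply Hs2, Hz.
  - assert (H := glue_derive Q1 Q2 (fun y => phi (P1 y) - c * Q1 y) (fun y => phi (P2 y) - c * Q2 y)).
    replace (phi (glue P1 P2 y) - c * glue Q1 Q2 y)
      with (glue (fun y => phi (P1 y) - c * Q1 y) (fun y => phi (P2 y) - c * Q2 y) y)
      by (unfold glue; destruct Rle_dec; reflexivity).
    apply H; auto.
    + rewrite E0, E1. reflexivity.
    + intros z Hz. unfold P1, Q1. destruct (Hxs (- z) ltac:(lra)) as [_ H1].
      rewrite Hpsi_eq in H1 by lra.
      auto_derive; [eexists; exact H1|].
      replace (Derive (fun x0 => r x0) (- z)) with (phi (b + x (- z)) + c * r (- z))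
        by (symmetry; apply is_derive_unique, H1). ring.
    + intros z Hz. destruct (Hs2 z Hz) as [_ H1].
      rewrite Hphic_eq in H1 by (specialize (Htrap z Hz); lra).
      replace (phi (P2 z) - c * Q2 z) with (phi (P2 z) + - c * Q2 z) by ring. exact H1.
  - split; [|split; [|split; [|split]]].
  + intros y. destruct (Rle_lt_dec y 0) as [Hy|Hy].
    * rewrite glue_nonpos by lra. unfold P1. specialize (Hxin (- y) ltac:(lra)). lra.
    * rewrite glue_nonneg by (auto; lra). apply Htrap; lra.
  + apply is_lim_spec. intros eps. destruct (is_lim_p_infty_elim x 0 eps Hxlim (cond_pos eps)) as [T [HT0 HT]].
    exists (- T). intros y Hy. rewrite glue_nonpos by lra. unfold P1.
    replace (b + x (- y) - b) with (x (- y) - 0) by ring. apply HT. lra.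
  + apply is_lim_spec. intros eps. destruct (is_lim_p_infty_elim r 0 eps Hrlim (cond_pos eps)) as [T [HT0 HT]].
    exists (- T). intros y Hy. rewrite glue_nonpos by lra. unfold Q1.
    replace (- r (- y) - 0) with (- (r (- y) - 0)) by ring. rewrite Rabs_Ropp. apply HT. lra.
  + apply is_lim_ext_loc with P2; [|exact HP2lim]. exists 0. intros y Hy.
    symmetry. apply glue_nonneg; [exact E0 | lra].
  + apply is_lim_ext_loc with Q2; [|exact HQ2lim]. exists 0. intros y Hy.
    symmetry. apply glue_nonneg; [exact E1 | lra].
Qed.

(** * Oscillation around the well *)

Lemma is_lim_m_infty_elim (f : R -> R) (l eps : R) :
  is_lim f m_infty l -> 0 < eps -> exists T, forall t, t <= T -> Rabs (f t - l) < eps.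
Proof.
  intros H He. apply is_lim_spec in H. destruct (H (mkposreal _ He)) as [T HT].
  exists (T - 1). intros t Ht. apply HT. lra.
Qed.

(** Sturm comparison.  [z = exp (c y / 2) (P - a)] satisfies [z'' <= - kap z]; with
    [om^2 = kap], the Wronskian [S] of [z] and [sin (om (y - Y))] is nonincreasing over
    half a period of the sine, but it goes from [- om z Y < 0] to [om z Z > 0]. *)
Lemma oscillating_not_positive (phi : R -> R) (c a kap Y : R) (P Q : R -> R) :
  0 < kap ->
  (forall y, is_derive P y (Q y) /\ is_derive Q y (phi (P y) - c * Q y)) ->
  (forall y, Y <= y -> a < P y) ->
  (forall y, Y <= y -> phi (P y) <= - (c ^ 2 / 4 + kap) * (P y - a)) -> False.
Proof.
  intros Hk Hs Hpos Hphi.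
  set (om := sqrt kap). assert (Hom : 0 < om) by (apply sqrt_lt_R0, Hk).
  assert (Hom2 : om * om = kap) by (apply sqrt_sqrt; lra).
  set (S := fun y => exp (c / 2 * y) * ((Q y + c / 2 * (P y - a)) * sin (om * (y - Y))
     - om * (P y - a) * cos (om * (y - Y)))).
  set (Z := Y + PI / om).
  assert (HPI := PI_RGT_0).
  assert (HZ : Y <= Z) by (assert (0 < PI / om) by (apply Rdiv_lt_0_compat; lra); unfold Z; lra).
  assert (HS : S Z <= S Y + 0 * (Z - Y)).
  { apply (derive_le_growth S (fun y => exp (c / 2 * y) *
      ((phi (P y) + (c ^ 2 / 4 + kap) * (P y - a)) * sin (om * (y - Y)))) Y Z 0 HZ).
    - intros y _. destruct (Hs y) as [H1 H2]. unfold S.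
      auto_derive; [repeat split; eexists; eassumption|].
      replace (Derive (fun x => P x) y) with (Q y) by (symmetry; apply is_derive_unique, H1).
      replace (Derive (fun x => Q x) y) with (phi (P y) - c * Q y)
        by (symmetry; apply is_derive_unique, H2).
      rewrite <- Hom2. change (y + - Y) with (y - Y). field.
    - intros y Hy. assert (Hsin : 0 <= sin (om * (y - Y))).
      { apply sin_ge_0; [apply Rmult_le_pos; lra|].
        replace PI with (om * (Z - Y)) by (unfold Z; field; lra).
        apply Rmult_le_compat_l; lra. }
      assert (H := Hphi y (proj1 Hy)). assert (He := exp_pos (c / 2 * y)).
      assert (H0 : (phi (P y) + (c ^ 2 / 4 + kap) * (P y - a)) * sin (om * (y - Y)) <= 0) by nra.
      nra. }
  unfold S in HS. replace (om * (Z - Y)) with PI in HS by (unfold Z; field; lra).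
  replace (om * (Y - Y)) with 0 in HS by ring.
  rewrite sin_PI, cos_PI, sin_0, cos_0 in HS.
  assert (HY := Hpos Y (Rle_refl Y)). assert (HPZ := Hpos Z HZ).
  assert (H1 := Rmult_lt_0_compat _ _ (exp_pos (c / 2 * Z)) (Rmult_lt_0_compat _ _ Hom (proj2 (Rlt_0_minus _ _) HPZ))).
  assert (H2 := Rmult_lt_0_compat _ _ (exp_pos (c / 2 * Y)) (Rmult_lt_0_compat _ _ Hom (proj2 (Rlt_0_minus _ _) HY))).
  nra.
Qed.

(** A monotone orbit that touched [a] would rest there from then on, and uniqueness,
    applied backwards in time, would make it constant. *)
Lemma connection_avoids_limit (phi : R -> R) (L c a b : R) (P Q : R -> R) :
  0 < L -> a < b ->
  (forall x y, a <= x <= b -> a <= y <= b -> Rabs (phi x - phi y) <= L * Rabs (x - y)) ->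
  phi a = 0 ->
  (forall y, is_derive P y (Q y) /\ is_derive Q y (phi (P y) - c * Q y)) ->
  (forall y, a <= P y <= b) -> decreasing P -> is_lim P m_infty b ->
  forall y, a < P y.
Proof.
  intros HL Hab Hlip Hphia Hs HP Hdec Hlim y0.
  destruct (proj1 (HP y0)) as [H|H]; [exact H | exfalso].
  assert (Hc : forall y, y0 <= y -> P y = a).
  { intros y Hy. assert (H1 := HP y). assert (H2 := Hdec y0 y Hy). lra. }
  set (y1 := y0 + 1).
  assert (HQ1 : Q y1 = 0).
  { destruct (Hs y1) as [H1 _]. apply is_derive_unique in H1. rewrite <- H1.
    rewrite (Derive_ext_loc P (fun _ => a)); [apply Derive_const|].
    exists (mkposreal 1 Rlt_0_1). intros z Hz. apply Rabs_def2 in Hz.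
    unfold minus, plus, opp in Hz; simpl in Hz. apply Hc. unfold y1 in Hz. lra. }
  set (phic := fun x => phi (clamp a b x)).
  assert (Hphic : lipschitz L phic) by (apply lipschitz_clamp; auto; lra).
  assert (S1 : phase_curve phic c (fun t => P (y1 - t)) (fun t => - Q (y1 - t))).
  { intros t _. destruct (Hs (y1 - t)) as [H1 H2].
    unfold phic. rewrite clamp_id by apply HP. split.
    - auto_derive; [eexists; exact H1|]. change (y1 + - t) with (y1 - t).
      replace (Derive (fun x => P x) (y1 - t)) with (Q (y1 - t))
        by (symmetry; apply is_derive_unique, H1). ring.
    - auto_derive; [eexists; exact H2|]. change (y1 + - t) with (y1 - t).
      replace (Derive (fun x => Q x) (y1 - t)) with (phi (P (y1 - t)) - c * Q (y1 - t))
        by (symmetry; apply is_derive_unique, H2). ring. }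
  assert (S2 : phase_curve phic c (fun _ => a) (fun _ => 0)).
  { intros t _. unfold phic. rewrite clamp_id, Hphia, Rmult_0_r, Rplus_0_r by lra.
    split; apply (is_derive_const (V := R_NormedModule)). }
  destruct (is_lim_m_infty_elim P b (b - a) Hlim ltac:(lra)) as [T HT].
  set (t := Rmax 0 (y1 - T)).
  assert (Ht0 := Rmax_l 0 (y1 - T)). assert (Ht1 := Rmax_r 0 (y1 - T)). fold t in Ht0, Ht1.
  assert (Hy1 : P y1 = a) by (apply Hc; unfold y1; lra).
  destruct (phase_curve_unique phic L c _ _ _ _ t HL Hphic S1 S2) as [E _];
    [rewrite Rminus_0_r; exact Hy1 | rewrite Rminus_0_r, HQ1; ring | exact Ht0 |].
  specialize (HT (y1 - t) ltac:(lra)). rewrite E in HT. rewrite Rabs_left in HT; lra.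
Qed.

(** [c^2 / 4 < - D] says that the characteristic polynomial [x^2 + c x - D] of the
    linearisation at [a] has negative discriminant.  The strict inequality leaves room for the error [o(P - a)] of [phi], which is
    absorbed in half of the gap. *)
Theorem underdamped_connection_non_monotone (phi : R -> R) (L c D a b : R) (P Q : R -> R) :
  0 < L -> a < b ->
  (forall x y, a <= x <= b -> a <= y <= b -> Rabs (phi x - phi y) <= L * Rabs (x - y)) ->
  phi a = 0 -> is_derive phi a D -> c ^ 2 / 4 < - D ->
  (forall y, is_derive P y (Q y) /\ is_derive Q y (phi (P y) - c * Q y)) ->
  is_lim P m_infty b -> is_lim P p_infty a -> non_monotone P.
Proof.
  intros HL Hab Hlip Hphia HD Hdisc Hs Hm Hp [Hinc|Hdec].
  - destruct (is_lim_m_infty_elim P b ((b - a) / 2) Hm ltac:(lra)) as [T1 H1].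
    destruct (is_lim_p_infty_elim P a ((b - a) / 2) Hp ltac:(lra)) as [T2 [H20 H2]].
    assert (Ha := Rmin_l T1 T2). assert (Hb := Rmin_r T1 T2).
    specialize (H1 _ Ha). specialize (H2 _ (Rle_refl T2)). specialize (Hinc _ _ Hb).
    apply Rabs_def2 in H1, H2. lra.
  - assert (HP : forall y, a <= P y <= b).
    { intros y. split; apply Rnot_lt_le; intros Hlt.
      - destruct (is_lim_p_infty_elim P a (a - P y) Hp ltac:(lra)) as [T [HT0 HT]].
        specialize (HT _ (Rmax_r y T)). specialize (Hdec _ _ (Rmax_l y T)).
        apply Rabs_def2 in HT. lra.
      - destruct (is_lim_m_infty_elim P b (P y - b) Hm ltac:(lra)) as [T HT].
        specialize (HT _ (Rmin_r y T)). specialize (Hdec _ _ (Rmin_l y T)).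
        apply Rabs_def2 in HT. lra. }
    assert (Hpos := connection_avoids_limit phi L c a b P Q HL Hab Hlip Hphia Hs HP Hdec Hm).
    set (kap := (- D - c ^ 2 / 4) / 2). assert (Hk : 0 < kap) by (unfold kap; lra).
    apply is_derive_Reals in HD. destruct (HD kap Hk) as [d Hd].
    destruct (is_lim_p_infty_elim P a d Hp (cond_pos d)) as [Y [_ HY]].
    apply (oscillating_not_positive phi c a kap Y P Q Hk Hs); [intros; apply Hpos|].
    intros y Hy. specialize (HY y Hy). specialize (Hpos y).
    specialize (Hd (P y - a) ltac:(lra) HY).
    replace (a + (P y - a)) with (P y) in Hd by ring. rewrite Hphia, Rminus_0_r in Hd.
    apply Rabs_def2 in Hd.
    assert (H1 : phi (P y) / (P y - a) <= - (c ^ 2 / 4 + kap)) by (unfold kap in *; lra).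
    apply Rmult_le_compat_r with (r := P y - a) in H1; [|lra].
    replace (phi (P y) / (P y - a) * (P y - a)) with (phi (P y)) in H1 by (field; lra). exact H1.
Qed.

(** * The profile function *)

Lemma C1_lipschitz (f df : R -> R) (u v : R) :
  u <= v -> (forall x, u <= x <= v -> is_derive f x (df x)) ->
  (forall x, u <= x <= v -> continuity_pt df x) ->
  exists L, 0 < L /\ forall x y, u <= x <= v -> u <= y <= v -> Rabs (f x - f y) <= L * Rabs (x - y).
Proof.
  intros Huv Hd Hc.
  destruct (continuity_ab_maj (fun x => Rabs (df x)) u v Huv) as [m [Hm Hmin]].
  { intros x Hx. apply (continuity_pt_comp df Rabs); [apply Hc, Hx | apply Rcontinuity_abs]. }
  exists (Rabs (df m) + 1). assert (H0 := Rabs_pos (df m)). split; [lra|].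
  assert (Hlt : forall x y, u <= x <= v -> u <= y <= v -> x < y ->
     Rabs (f x - f y) <= (Rabs (df m) + 1) * Rabs (x - y)).
  { intros x y Hx Hy Hxy.
    destruct (mvt_lt f df x y Hxy (fun t Ht => Hd t ltac:(lra))) as [z [Hz E]].
    rewrite (Rabs_minus_sym (f x)), (Rabs_minus_sym x), E, Rabs_mult.
    apply Rmult_le_compat_r; [apply Rabs_pos|]. specialize (Hm z ltac:(lra)). lra. }
  intros x y Hx Hy. destruct (Rtotal_order x y) as [H|[H|H]].
  - apply Hlt; assumption.
  - subst y. rewrite !Rminus_diag, Rabs_R0. lra.
  - rewrite (Rabs_minus_sym (f x)), (Rabs_minus_sym x). apply Hlt; assumption.
Qed.

Lemma enthalpy_derive (gamma rho : R) :
  0 < rho -> is_derive (enthalpy gamma) rho (gamma * Rpower rho (gamma - 2)).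
Proof.
  intros Hr. unfold enthalpy. destruct (Req_dec_T gamma 1) as [->|Hg].
  - replace (1 * Rpower rho (1 - 2)) with (/ rho).
    + apply is_derive_ln, Hr.
    + replace (1 - 2) with (- (1)) by ring. rewrite Rpower_Ropp, Rpower_1 by exact Hr. ring.
  - replace (gamma * Rpower rho (gamma - 2))
      with (gamma / (gamma - 1) * ((gamma - 1) * Rpower rho (gamma - 1 - 1))).
    + apply (is_derive_scal (fun r => Rpower r (gamma - 1))).
      apply is_derive_Reals, derivable_pt_lim_power, Hr.
    + replace (gamma - 1 - 1) with (gamma - 2) by ring. field. lra.
Qed.

Definition profile_factor (gamma s A B P : R) : R :=
  1 / 2 * (A ^ 2 / P ^ 4 - s ^ 2) + enthalpy gamma (P ^ 2) + B.

(** With [rho = P^2], this is [rho^2] times the squared sound speed [gamma rho^(gamma - 1)],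
    while [A^2] is [rho^2] times the squared velocity relative to the wave; so
    [sonic gamma P < A ^ 2] says that the flow is supersonic. *)
Definition sonic (gamma P : R) : R := gamma * Rpower (P ^ 2) (gamma + 1).

Lemma profile_factor_derive (gamma s A B P : R) :
  0 < P -> is_derive (profile_factor gamma s A B) P (2 / P ^ 5 * (sonic gamma P - A ^ 2)).
Proof.
  intros HP. assert (HP2 : 0 < P ^ 2) by (apply pow_lt, HP).
  assert (He := enthalpy_derive gamma (P ^ 2) HP2).
  unfold profile_factor. auto_derive.
  - split; [|split; [eexists; exact He | trivial]]. repeat apply Rmult_integral_contrapositive_currified; lra.
  - replace (Derive (fun x => enthalpy gamma x) (P * (P * 1))) with (gamma * Rpower (P ^ 2) (gamma - 2))
      by (symmetry; apply is_derive_unique, He).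
    unfold sonic. replace (gamma + 1) with (gamma - 2 + INR 3) by (simpl; ring).
    rewrite Rpower_plus, Rpower_pow by exact HP2. field. lra.
Qed.

Lemma sonic_increasing (gamma P P' : R) :
  1 <= gamma -> 0 < P < P' -> sonic gamma P < sonic gamma P'.
Proof.
  intros Hg HP. unfold sonic. apply Rmult_lt_compat_l; [lra|].
  apply Rlt_Rpower_l; [lra|]. split; [apply pow_lt; lra | nra].
Qed.

Lemma derive_pos_increasing (f df : R -> R) (x y : R) :
  x < y -> (forall t, x <= t <= y -> is_derive f t (df t)) ->
  (forall t, x < t < y -> 0 < df t) -> f x < f y.
Proof.
  intros Hxy Hd Hp. destruct (mvt_lt f df x y Hxy Hd) as [z [Hz E]].
  specialize (Hp z Hz). nra.
Qed.

(** By Rolle the derivative vanishes at some [m] between [a] and [b]; as [sonic] is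
    increasing, the factor decreases up to [m] and increases after it. *)
Lemma profile_factor_valley (gamma s A B a b : R) :
  1 <= gamma -> 0 < a < b ->
  profile_factor gamma s A B a = 0 -> profile_factor gamma s A B b = 0 ->
  sonic gamma a < A ^ 2 /\
  (forall P, 0 < P < a -> 0 < profile_factor gamma s A B P) /\
  (forall P, a < P < b -> profile_factor gamma s A B P < 0).
Proof.
  intros Hg Hab Ha Hb.
  set (g := profile_factor gamma s A B) in *.
  set (dg := fun P => 2 / P ^ 5 * (sonic gamma P - A ^ 2)).
  assert (Hd : forall P, 0 < P -> is_derive g P (dg P)) by (intros; apply profile_factor_derive; auto).
  destruct (mvt_lt g dg a b (proj2 Hab) (fun t Ht => Hd t ltac:(lra))) as [m [Hm E]].
  assert (Hpos5 : forall P, 0 < P -> 0 < 2 / P ^ 5)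
    by (intros P HP; apply Rdiv_lt_0_compat; [lra | apply pow_lt, HP]).
  assert (HA : sonic gamma m = A ^ 2).
  { rewrite Ha, Hb in E. unfold dg in E. specialize (Hpos5 m ltac:(lra)).
    assert (H : 2 / m ^ 5 * (sonic gamma m - A ^ 2) = 0) by nra. nra. }
  assert (Hdec : forall x y, 0 < x < y -> y <= m -> g y < g x).
  { intros x y Hxy Hym. apply Ropp_lt_cancel.
    apply (derive_pos_increasing (fun P => - g P) (fun P => - dg P)); [lra | |].
    - intros t Ht. apply (is_derive_opp (V := R_NormedModule) g), Hd. lra.
    - intros t Ht. assert (H := sonic_increasing gamma t m Hg ltac:(lra)).
      specialize (Hpos5 t ltac:(lra)). unfold dg. nra. }
  assert (Hinc : forall x y, m <= x < y -> g x < g y).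
  { intros x y Hxy. apply (derive_pos_increasing g dg); [lra | |].
    - intros t Ht. apply Hd. lra.
    - intros t Ht. assert (H := sonic_increasing gamma m t Hg ltac:(lra)).
      specialize (Hpos5 t ltac:(lra)). unfold dg. nra. }
  split; [|split].
  - rewrite <- HA. apply sonic_increasing; [exact Hg | lra].
  - intros P HP. rewrite <- Ha. apply Hdec; lra.
  - intros P HP. destruct (Rle_lt_dec P m) as [H|H].
    + rewrite <- Ha. apply Hdec; lra.
    + rewrite <- Hb. apply Hinc; lra.
Qed.

Definition profile_df (gamma s A B P : R) : R :=
  profile_factor gamma s A B P + P * (2 / P ^ 5 * (sonic gamma P - A ^ 2)).

Lemma profile_derive (gamma s A B P : R) :
  0 < P -> is_derive (profile_f gamma s A B) P (profile_df gamma s A B P).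
Proof.
  intros HP. assert (H := profile_factor_derive gamma s A B P HP).
  apply is_derive_ext with (fun P => profile_factor gamma s A B P * P); [reflexivity|].
  unfold profile_df.
  set (g := profile_factor gamma s A B) in *. set (l := 2 / P ^ 5 * _) in *.
  auto_derive; [exists l; exact H|].
  replace (Derive (fun x => g x) P) with l by (symmetry; apply is_derive_unique, H). ring.
Qed.

Lemma profile_df_continuity (gamma s A B P : R) :
  0 < P -> continuity_pt (profile_df gamma s A B) P.
Proof.
  intros HP. assert (HP2 : 0 < P ^ 2) by (apply pow_lt, HP).
  assert (Hf := profile_factor_derive gamma s A B P HP).
  assert (HR := proj2 (is_derive_Reals _ _ _) (derivable_pt_lim_power (P ^ 2) (gamma + 1) HP2)).
  assert (He : ex_derive (profile_df gamma s A B) P).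
  { unfold profile_df, sonic. set (g := profile_factor gamma s A B) in *.
    set (h := fun x => Rpower x (gamma + 1)) in *.
    change (ex_derive (fun P => g P + P * (2 / P ^ 5 * (gamma * h (P ^ 2) - A ^ 2))) P).
    auto_derive. split; [eexists; exact Hf|].
    split; [repeat apply Rmult_integral_contrapositive_currified; lra|].
    split; [eexists; exact HR | trivial]. }
  destruct He as [l Hl]. apply is_derive_continuity_pt with l, Hl.
Qed.

(** With [kap = A^2 - sonic a > 0], comparing derivatives gives
    [kap / 2 (P^-4 - a^-4) <= profile_factor P] on [(0, a]], hence a lower bound for [f] of
    order [P^-3], whose integral over [[eta, a]] grows like [eta^-2] and outweighs the
    integral of [f] over [[a, b]]. *)
Lemma profile_integral_nonneg (gamma s A B a b : R) :
  1 <= gamma -> 0 < a < b ->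
  profile_factor gamma s A B a = 0 -> profile_factor gamma s A B b = 0 ->
  exists eta, 0 < eta < a /\ 0 <= RInt (profile_f gamma s A B) eta b.
Proof.
  intros Hg Hab Ha Hb.
  destruct (profile_factor_valley gamma s A B a b Hg Hab Ha Hb) as [HA _].
  set (kap := A ^ 2 - sonic gamma a) in *. assert (Hk : 0 < kap) by (unfold kap; lra).
  assert (Hint : forall u v, 0 < u -> 0 < v -> ex_RInt (profile_f gamma s A B) u v).
  { intros u v Hu Hv. apply (ex_RInt_continuous (V := R_CompleteNormedModule)). intros z Hz.
    assert (Hz0 : 0 < z) by (assert (0 < Rmin u v) by (apply Rmin_glb_lt; assumption); lra).
    apply (ex_derive_continuous (V := R_NormedModule)). eexists. apply profile_derive, Hz0. }
  assert (Hlow : forall P, 0 < P <= a -> kap / 2 * (/ P ^ 4 - / a ^ 4) <= profile_factor gamma s A B P).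
  { intros P HP.
    set (w := fun x => profile_factor gamma s A B x - kap / 2 * / x ^ 4).
    assert (Hw : w a <= w P + 0 * (a - P)).
    { apply (derive_le_growth w (fun x => 2 / x ^ 5 * (sonic gamma x - sonic gamma a)) P a 0 (proj2 HP)).
      - intros x Hx. assert (H := profile_factor_derive gamma s A B x ltac:(lra)).
        unfold w. auto_derive.
        + split; [eexists; exact H|]. split; [|trivial].
          repeat apply Rmult_integral_contrapositive_currified; lra.
        + replace (Derive (fun x0 => profile_factor gamma s A B x0) x)
            with (2 / x ^ 5 * (sonic gamma x - A ^ 2)) by (symmetry; apply is_derive_unique, H).
          unfold kap. field. lra.
      - intros x Hx. assert (H : sonic gamma x <= sonic gamma a).
        { destruct (proj2 Hx) as [H|H]; [left; apply sonic_increasing; lra | rewrite H; lra]. }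
        assert (H5 : 0 < 2 / x ^ 5) by (apply Rdiv_lt_0_compat; [lra | apply pow_lt; lra]). nra. }
    unfold w in Hw. rewrite Ha in Hw. lra. }
  set (I := RInt (profile_f gamma s A B) a b).
  (* as soon as [1 / eta^2 >= N], the lower bound on [[eta, a]] is at least [Rabs I] *)
  set (N := 4 / kap * (Rabs I + kap / (2 * a ^ 2))).
  assert (Ha2 : 0 < a ^ 2) by (apply pow_lt; lra).
  assert (HN : 0 <= N).
  { apply Rmult_le_pos; [left; apply Rdiv_lt_0_compat; lra|].
    assert (H := Rabs_pos I). assert (H' : 0 < kap / (2 * a ^ 2)) by (apply Rdiv_lt_0_compat; lra). lra. }
  set (eta := Rmin (a / 2) (/ (1 + N))).
  assert (H1 : eta <= a / 2) by apply Rmin_l. assert (H2 : eta <= / (1 + N)) by apply Rmin_r.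
  assert (H0 : 0 < eta) by (apply Rmin_glb_lt; [lra | apply Rinv_0_lt_compat; lra]).
  exists eta. split; [lra|].
  assert (Hinv : N <= / eta ^ 2).
  { assert (H3 : 1 + N <= / eta).
    { rewrite <- (Rinv_inv (1 + N)). apply Rinv_le_contravar; assumption. }
    replace (/ eta ^ 2) with (/ eta * / eta) by (field; lra). nra. }
  set (K := fun P => kap / 2 * (- / (2 * P ^ 2) - P ^ 2 / (2 * a ^ 4))).
  assert (HK : is_RInt (fun P => kap / 2 * (/ P ^ 4 - / a ^ 4) * P) eta a (K a - K eta)).
  { apply (is_RInt_derive (V := R_CompleteNormedModule) K).
    - intros x Hx. rewrite Rmin_left, Rmax_right in Hx by lra. unfold K. auto_derive.
      + repeat apply Rmult_integral_contrapositive_currified; lra.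
      + field. lra.
    - intros x Hx. rewrite Rmin_left, Rmax_right in Hx by lra.
      apply (ex_derive_continuous (V := R_NormedModule)). auto_derive.
      repeat apply Rmult_integral_contrapositive_currified; lra. }
  assert (Hge : K a - K eta <= RInt (profile_f gamma s A B) eta a).
  { rewrite <- (is_RInt_unique _ _ _ _ HK). apply RInt_le; [lra | eexists; exact HK | apply Hint; lra |].
    intros x Hx. change (profile_f gamma s A B x) with (profile_factor gamma s A B x * x).
    apply Rmult_le_compat_r; [lra | apply Hlow; lra]. }
  assert (Hval : kap / 4 * / eta ^ 2 - kap / (2 * a ^ 2) <= K a - K eta).
  { unfold K.
    replace (kap / 2 * (- / (2 * a ^ 2) - a ^ 2 / (2 * a ^ 4))
       - kap / 2 * (- / (2 * eta ^ 2) - eta ^ 2 / (2 * a ^ 4)))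
      with (kap / 4 * / eta ^ 2 - kap / (2 * a ^ 2) + kap / 4 * (eta ^ 2 / a ^ 4)) by (field; lra).
    assert (0 < eta ^ 2 / a ^ 4) by (apply Rdiv_lt_0_compat; apply pow_lt; lra). nra. }
  assert (HNk : kap / 4 * N = Rabs I + kap / (2 * a ^ 2)) by (unfold N; field; lra).
  assert (HI : - Rabs I <= I) by (unfold Rabs; destruct Rcase_abs; lra).
  assert (Hch := RInt_Chasles (V := R_CompleteNormedModule) (profile_f gamma s A B) eta a b
    (Hint eta a H0 ltac:(lra)) (Hint a b ltac:(lra) ltac:(lra))).
  unfold plus in Hch; simpl in Hch. fold I in Hch. rewrite <- Hch.
  assert (kap / 4 * N <= kap / 4 * / eta ^ 2) by (apply Rmult_le_compat_l; lra).
  lra.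
Qed.

(** [sig] stands for [|s|]: since [f] contains only [s^2], both signs of the speed lead to
    this case, with [a] the smaller end value. *)
Lemma profile_heteroclinic (gamma mu k s sig A B a b : R) :
  1 <= gamma -> 0 < mu -> 0 < k -> 0 < sig -> 0 < a < b ->
  let f := profile_f gamma s A B in
  f a = 0 -> f b = 0 ->
  (exists P Q, heteroclinic k mu sig f b a P Q) /\
  (sig * mu / k < sqrt (- Derive f a) ->
     forall P Q, heteroclinic k mu sig f b a P Q -> non_monotone P).
Proof.
  intros Hg Hmu Hk Hsig Hab f Hfa Hfb.
  assert (Hzero : forall P, 0 < P -> f P = 0 -> profile_factor gamma s A B P = 0).
  { intros P HP H. change (f P) with (profile_factor gamma s A B P * P) in H. nra. }
  assert (Hga := Hzero a ltac:(lra) Hfa). assert (Hgb := Hzero b ltac:(lra) Hfb).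
  destruct (profile_factor_valley gamma s A B a b Hg Hab Hga Hgb) as [_ [Hpos Hneg]].
  destruct (profile_integral_nonneg gamma s A B a b Hg Hab Hga Hgb) as [eta [Heta Hint]].
  assert (Hk2 : 0 < k ^ 2) by (apply pow_lt, Hk).
  assert (Hk2' : 0 < / k ^ 2) by (apply Rinv_0_lt_compat, Hk2).
  set (c := 2 * sig * mu / k ^ 2).
  assert (Hc : 0 < c).
  { apply Rdiv_lt_0_compat; [|exact Hk2]. repeat apply Rmult_lt_0_compat; lra. }
  set (phi := fun P => f P / k ^ 2).
  assert (Hdphi : forall P, 0 < P -> is_derive phi P (profile_df gamma s A B P / k ^ 2)).
  { intros P HP. unfold phi, Rdiv.
    assert (H := is_derive_scal f P (/ k ^ 2) _ (profile_derive gamma s A B P HP)).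
    rewrite Rmult_comm. apply is_derive_ext with (2 := H). intros t. apply Rmult_comm. }
  destruct (C1_lipschitz phi (fun P => profile_df gamma s A B P / k ^ 2) eta b ltac:(lra)
     (fun x Hx => Hdphi x ltac:(lra))) as [L [HL Hlip]].
  { intros x Hx. apply continuity_pt_mult; [apply profile_df_continuity; lra|].
    apply continuity_pt_const; intros ? ?; reflexivity. }
  split.
  - destruct (damped_heteroclinic_exists phi L c eta a b) as [P [Q [Hs [HP [H1 [H2 [H3 H4]]]]]]];
      try assumption; try lra.
    + unfold phi. rewrite Hfa. unfold Rdiv. ring.
    + unfold phi. rewrite Hfb. unfold Rdiv. ring.
    + intros x Hx. apply Rmult_lt_0_compat; [|exact Hk2'].
      apply Rmult_lt_0_compat; [|lra]. apply Hpos; lra.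
    + intros x Hx. specialize (Hneg x Hx).
      assert (Hfx : f x < 0).
      { change (f x) with (profile_factor gamma s A B x * x). nra. }
      unfold phi, Rdiv. nra.
    + assert (Hex : ex_RInt f eta b).
      { apply (ex_RInt_continuous (V := R_CompleteNormedModule)). intros z Hz.
        rewrite Rmin_left in Hz by lra.
        apply (ex_derive_continuous (V := R_NormedModule)). eexists. apply profile_derive. lra. }
      assert (Hi := is_RInt_scal (V := R_NormedModule) f eta b (/ k ^ 2) _
        (RInt_correct (V := R_CompleteNormedModule) f eta b Hex)).
      apply (is_RInt_ext (V := R_NormedModule)) with (g := phi) in Hi.
      * rewrite (is_RInt_unique _ _ _ _ Hi). apply Rmult_le_pos; [lra | exact Hint].
      * intros x _. apply Rmult_comm.
    + exists P, Q. split; [exact Hs|]. split; [intros y; specialize (HP y); lra|]. auto.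
  - intros Hsmall P Q [Hs [HP [H1 [H2 [H3 H4]]]]].
    apply (underdamped_connection_non_monotone phi L c (Derive f a / k ^ 2) a b P Q); auto; try lra.
    + intros x y Hx Hy. apply Hlip; lra.
    + unfold phi. rewrite Hfa. unfold Rdiv. ring.
    + replace (Derive f a) with (profile_df gamma s A B a)
        by (symmetry; apply is_derive_unique, profile_derive; lra).
      apply Hdphi. lra.
    + assert (Hr : 0 < sig * mu / k) by (apply Rdiv_lt_0_compat; [apply Rmult_lt_0_compat; lra | exact Hk]).
      assert (HD : 0 < - Derive f a).
      { apply Rnot_le_lt. intros H. rewrite sqrt_neg_0 in Hsmall by exact H. lra. }
      assert (Hsq := sqrt_sqrt (- Derive f a) ltac:(lra)).
      assert (Hlt : (sig * mu / k) ^ 2 < - Derive f a) by (simpl; nra).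
      apply Rmult_lt_compat_r with (1 := Hk2') in Hlt.
      replace (c ^ 2 / 4) with ((sig * mu / k) ^ 2 * / k ^ 2) by (unfold c; field; lra).
      unfold Rdiv in *. lra.
Qed.

Lemma heteroclinic_reverse (k mu s : R) (f P Q : R -> R) (Pm Pp : R) :
  heteroclinic k mu s f Pm Pp P Q ->
  heteroclinic k mu (- s) f Pp Pm (fun y => P (- y)) (fun y => - Q (- y)).
Proof.
  intros [Hs [HP [H1 [H2 [H3 H4]]]]].
  assert (Hlim : forall (g : R -> R) (x : Rbar) (l : R),
    (x = p_infty \/ x = m_infty) -> is_lim g x l -> is_lim (fun y => g (- y)) (Rbar_opp x) l).
  { intros g x l Hx Hg. apply (is_lim_comp g Ropp _ l x).
    - exact Hg.
    - rewrite <- (Rbar_opp_involutive x) at 2. apply is_lim_opp, is_lim_id.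
    - destruct Hx as [-> | ->]; exists 0; intros y _; discriminate. }
  split; [|split; [|split; [|split; [|split]]]].
  - intros y. destruct (Hs (- y)) as [E1 E2]. split.
    + auto_derive; [eexists; exact E1|].
      replace (Derive (fun x => P x) (- y)) with (Q (- y)) by (symmetry; apply is_derive_unique, E1). ring.
    + auto_derive; [eexists; exact E2|].
      replace (Derive (fun x => Q x) (- y)) with (f (P (- y)) / k ^ 2 - 2 * s * mu / k ^ 2 * Q (- y))
        by (symmetry; apply is_derive_unique, E2). unfold Rdiv. ring.
  - intros y. apply HP.
  - apply (Hlim P p_infty Pp (or_introl eq_refl) H3).
  - rewrite <- Ropp_0. apply (is_lim_opp _ _ 0), (Hlim Q p_infty 0 (or_introl eq_refl) H4).
  - apply (Hlim P m_infty Pm (or_intror eq_refl) H1).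
  - rewrite <- Ropp_0. apply (is_lim_opp _ _ 0), (Hlim Q m_infty 0 (or_intror eq_refl) H2).
Qed.

Lemma non_monotone_reverse (P : R -> R) : non_monotone (fun y => P (- y)) -> non_monotone P.
Proof.
  intros H [Hi|Hd]; apply H; [right | left]; intros x y Hxy; [apply Hi | apply Hd]; lra.
Qed.

Theorem lemma1 (gamma mu k Pm Pp um up s : R)
  (hgamma : 1 <= gamma) (hmu : 0 < mu) (hk : 0 < k)
  (hPm : 0 < Pm) (hPp : 0 < Pp)
  (hRH : rankine_hugoniot gamma s Pm um Pp up) :
  let f : R -> R := profile_f gamma s (constA s Pp up) (constB gamma s Pp up) in
  (0 < s -> Pp < Pm ->
     (exists P Q : R -> R, heteroclinic k mu s f Pm Pp P Q) /\
     (s * mu / k < sqrt (- Derive f Pp) ->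
        forall P Q : R -> R, heteroclinic k mu s f Pm Pp P Q -> non_monotone P)) /\
  (s < 0 -> Pm < Pp ->
     (exists P Q : R -> R, heteroclinic k mu s f Pm Pp P Q) /\
     (- (s * mu / k) < sqrt (- Derive f Pm) ->
        forall P Q : R -> R, heteroclinic k mu s f Pm Pp P Q -> non_monotone P)).
Proof.
  intros f.
  assert (Hfp : f Pp = 0) by (apply profile_f_end, hPp).
  assert (Hfm : f Pm = 0).
  { unfold f. rewrite (constA_pm _ _ _ _ _ _ hRH), (constB_pm _ _ _ _ _ _ hRH).
    apply profile_f_end, hPm. }
  split; intros Hs HP.
  - apply profile_heteroclinic; auto; lra.
  - destruct (profile_heteroclinic gamma mu k s (- s) (constA s Pp up) (constB gamma s Pp up) Pm Pp)
      as [[P [Q HPQ]] Hnm]; auto; try lra.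
    fold f in HPQ, Hnm. split.
    + exists (fun y => P (- y)), (fun y => - Q (- y)).
      rewrite <- (Ropp_involutive s) at 1. apply heteroclinic_reverse, HPQ.
    + intros Hsmall P' Q' H'. apply non_monotone_reverse.
      apply (Hnm ltac:(replace (- s * mu / k) with (- (s * mu / k)) by (field; lra); exact Hsmall)
        _ (fun y => - Q' (- y))).
      apply heteroclinic_reverse, H'.
Qed.
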